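(* Let $p\ge1$ and let $(I_p(g_1),I_p(g_2))$ be a two-dimensional random vector with $g_1=(g_{1j})_{1\le j\le2^p}$, $g_2=(g_{2j})_{1\le j\le2^p}\in(\mathfrak{H}\oplus\mathfrak{H})^{\odot p}$, whose components are real multiple Wiener-Itô integrals with respect to $W$. If there exists a unique $0\le k\le p$ such that $$\begin{cases}\sum_{j=1}^{2^p}V_{kj}(g_{1j}+\mathrm{i}g_{2j})\ne0,\\ \sum_{j=1}^{2^p}V_{lj}(g_{1j}+\mathrm{i}g_{2j})=0,\quad l\ne k,\ 0\le l\le p,\end{cases}$$ then $$I_p(g_1)+\mathrm{i}I_p(g_2)=\mathcal{I}_{k,p-k}(g_{k,p-k}),\qquad g_{k,p-k}=\frac{2^{-p/2}\,p!}{k!(p-k)!}\sum_{j=1}^{2^p}V_{kj}(g_{1j}+\mathrm{i}g_{2j}).$$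
   Context: $\mathfrak{H}$ is a real separable Hilbert space, $\mathfrak{H}_{\mathbb{C}}$ its complexification (inner product linear in the first variable), $\mathfrak{H}\oplus\mathfrak{H}$ the Hilbert direct sum; $^{\odot n}$ is the $n$-th symmetric tensor power, $\mathrm{symm}$ the symmetrization. $X$, $Y$ are two independent isonormal Gaussian processes over $\mathfrak{H}$ (centered Gaussian families with $\mathbb{E}[X(h)X(g)]=\langle h,g\rangle_{\mathfrak{H}}$, likewise $Y$). $W(h,f)=X(h)+Y(f)$ is an isonormal Gaussian process over $\mathfrak{H}\oplus\mathfrak{H}$. For $\mathfrak{h}=f+\mathrm{i}g\in\mathfrak{H}_{\mathbb{C}}$ put $X_{\mathbb{C}}(\mathfrak{h})=X(f)+\mathrm{i}X(g)$, similarly $Y_{\mathbb{C}}$, and $Z(\mathfrak{h})=(X_{\mathbb{C}}(\mathfrak{h})+\mathrm{i}Y_{\mathbb{C}}(\mathfrak{h}))/\sqrt2$ (complex isonormal Gaussian process). $\Lambda$ is the set of sequences $\mathbf{a}=\{a_k\}_{k\ge1}$ of non-negative integers with finite sum $|\mathbf{a}|$. Real integrals: Hermite polynomials are defined by $\exp\{tx-t^2/2\}=\sum_n \frac{t^n}{n!}H_n(x)$. For a complete orthonormal system $\{\eta_k\}$ of $\mathfrak{H}\oplus\mathfrak{H}$, $I_n$ is the linear isometry from $(\mathfrak{H}\oplus\mathfrak{H})^{\odot n}$ with norm $\sqrt{n!}\|\cdot\|$ onto the $n$-th Wiener chaos of $W$ given by $I_n(\mathrm{symm}(\otimes_k\eta_k^{\otimes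 m_k}))=\prod_kH_{m_k}(W(\eta_k))$, $\mathbf m\in\Lambda$, $|\mathbf{m}|=n$. Complex integrals: complex Hermite polynomials are defined by $\exp\{\lambda\bar z+\bar\lambda z-2|\lambda|^2\}=\sum_{p,q\ge0}\frac{\bar\lambda^p\lambda^q}{p!q!}J_{p,q}(z)$. For a complete orthonormal system $\{\xi_k\}$ of $\mathfrak{H}_{\mathbb{C}}$, $\mathcal{I}_{p,q}$ is the linear isometry from $\mathfrak{H}_{\mathbb{C}}^{\odot p}\otimes\mathfrak{H}_{\mathbb{C}}^{\odot q}$ with norm $\sqrt{p!q!}\|\cdot\|$ into $L^2_{\mathbb{C}}(\Omega)$ given by $\mathcal{I}_{p,q}(\mathrm{symm}(\otimes_k\xi_k^{\otimes p_k})\otimes\mathrm{symm}(\otimes_k\overline{\xi}_k^{\otimes q_k}))=\prod_k2^{-(p_k+q_k)/2}J_{p_k,q_k}(\sqrt2Z(\xi_k))$, $\mathbf p,\mathbf q\in\Lambda$, $|\mathbf p|=p,|\mathbf q|=q$. For $1\le j\le2^p$ write $j-1=\sum_{l=1}^pa_{jl}2^{l-1}$ with $a_{jl}\in\{0,1\}$. An element $g\in(\mathfrak{H}\oplus\mathfrak{H})^{\otimes p}$ is identified with the column $(g_j)_{1\le j\le2^p}$ of its components $g_j\in\mathfrak{H}^{\otimes p}$, $g_j$ being the component whose $l$-th tensor factor lies in the first copy of $\mathfrak{H}$ if $a_{jl}=0$ and in the second copy if $a_{jl}=1$ (for each $l$). For $0\le k\le p$ let $b_{kj}$ be the number of $1$'s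 in $\{a_{j1},\dots,a_{jk}\}$ (counted with multiplicity, $b_{0j}=0$) and $c_{kj}$ the number of $1$'s in $\{a_{j,k+1},\dots,a_{jp}\}$ ($c_{pj}=0$), and put $V_{kj}=(-\mathrm{i})^{b_{kj}}\,\mathrm{i}^{c_{kj}}$. In $\mathfrak{H}_{\mathbb{C}}^{\odot k}\otimes\mathfrak{H}_{\mathbb{C}}^{\odot(p-k)}\subseteq\mathfrak{H}_{\mathbb{C}}^{\otimes p}$ the first $k$ tensor factors form the $\mathfrak{H}_{\mathbb{C}}^{\odot k}$ part. *)

(* Defs.v *)
From HB Require Import structures.
From mathcomp Require Import all_boot all_order all_algebra all_fingroup.
From mathcomp Require Import finmap.
From mathcomp Require Import all_classical all_reals all_analysis.
From mathcomp Require Import complex.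
From mathcomp Require Import ring lra.

Set Implicit Arguments.
Unset Strict Implicit.
Unset Printing Implicit Defensive.

Import Order.TTheory GRing.Theory Num.Theory.
Import numFieldNormedType.Exports.
(* after Num.Theory, so that Re and Im are the projections of R[i] *)
Import complex.

Local Open Scope classical_set_scope.
Local Open Scope ring_scope.

Section InnerProduct.
Context {K : numFieldType} {theta : K -> K} {V : lmodType K}.
Variable dot : {dot V for theta}.

Definition sqnorm (v : V) : K := dot v v.

Definition hcauchy (u : nat -> V) :=
  forall e : K, 0 < e -> exists N, forall m n,
    (N <= m)%N -> (N <= n)%N -> sqnorm (u m - u n) < e.

Definition hcvg (u : nat -> V) (v : V) :=
  forall e : K, 0 < e -> exists N, forall n, (N <= n)%N -> sqnorm (u n - v) < e.

Definition lin_span (S : set V) : set V :=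
  [set v | exists2 s : seq (K * V), {in s, forall x, S x.2} &
     v = \sum_(x <- s) x.1 *: x.2].

Definition closed_span (S : set V) : set V :=
  [set v | forall e : K, 0 < e -> exists2 w, lin_span S w & sqnorm (v - w) < e].

Lemma sqnorm_ge0 v : 0 <= sqnorm v.
Proof.
rewrite /sqnorm; have [->|v0] := eqVneq v 0; first by rewrite linear0l.
by rewrite ltW// neq0_dnorm_gt0.
Qed.

Lemma sqnorm_eq0 v : sqnorm v = 0 -> v = 0.
Proof.
rewrite /sqnorm => vv0; apply/eqP/negP => /negP v0.
by have := @neq0_dnorm_gt0 _ _ _ dot v v0; rewrite vv0 ltxx.
Qed.

Lemma sqnormD_le u v : sqnorm (u + v) <= (sqnorm u + sqnorm v) *+ 2.
Proof.
rewrite -subr_ge0.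
suff -> : (sqnorm u + sqnorm v) *+ 2 - sqnorm (u + v) = sqnorm (u - v).
  exact: sqnorm_ge0.
by rewrite /sqnorm !(linearDl, linearDr, linearNl, linearNr) /=; ring.
Qed.

Lemma closed_spanD (S : set V) u v :
  closed_span S u -> closed_span S v -> closed_span S (u + v).
Proof.
move=> Su Sv e e0; have e4 : 0 < e / 4 by rewrite divr_gt0.
have [u' [s sS ->] ue] := Su _ e4; have [v' [t tS ->] ve] := Sv _ e4.
exists (\sum_(x <- s ++ t) x.1 *: x.2).
  by exists (s ++ t) => // x; rewrite mem_cat => /orP[/sS|/tS].
rewrite big_cat /= opprD addrACA (le_lt_trans (sqnormD_le _ _))//.
rewrite [ltRHS](_ : _ = (e / 4 + e / 4) *+ 2); last by field.
by rewrite ltrMn2r /= ltrD.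
Qed.

Lemma closed_span0 (S : set V) : closed_span S 0.
Proof.
move=> e e0; exists 0; first by exists [::]; rewrite ?big_nil.
by rewrite subr0 /sqnorm linear0l.
Qed.

Lemma closed_span_sum (S : set V) (I : finType) (F : I -> V) :
  (forall i, closed_span S (F i)) -> closed_span S (\sum_i F i).
Proof.
move=> SF; elim/big_rec: _ => [|i x _ Sx]; first exact: closed_span0.
exact: closed_spanD.
Qed.
End InnerProduct.

Record hilbert (K : numFieldType) (theta : K -> K) := Hilbert {
  hsort :> lmodType K;
  hdot : {dot hsort for theta};
  hcomplete : forall u, hcauchy hdot u -> exists v, hcvg hdot u v }.

Notation real_hilbert R := (@hilbert R idfun).
Notation complex_hilbert R := (@hilbert R[i] (@conjc R)).
Notation "''<' u , v '>'" := (hdot _ u v)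
  (at level 2, u, v at level 59, format "''<' u ,  v '>'") : ring_scope.

Definition separable (K : numFieldType) (theta : K -> K) (H : hilbert theta) :=
  exists u : nat -> H, forall (v : H) (e : K), 0 < e ->
    exists n, sqnorm (hdot H) (v - u n) < e.

(* A complete orthonormal system; the index type is an arbitrary countable
   type because the space may be finite dimensional. *)
Definition is_cons (K : numFieldType) (theta : K -> K) (H : hilbert theta)
    (I : countType) (eta : I -> H) :=
  (forall i j, '<eta i, eta j> = (i == j)%:R) /\
  (forall v, closed_span (hdot H) (range eta) v).

Section TensorPower.
Variables (K : numFieldType) (theta : K -> K) (H : hilbert theta) (n : nat).

Definition upd (h : 'I_n -> H) (l : 'I_n) (x : H) : 'I_n -> H :=
  fun m => if m == l then x else h m.

(* The n-fold Hilbert tensor power of H, given by its (defining, up to unitary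
   isomorphism) properties. *)
Record tensor_power := TensorPower {
  tpow :> hilbert theta;
  tens : ('I_n -> H) -> tpow;
  tens_linear : forall h l (a : K) x y,
    tens (upd h l (a *: x + y)) = a *: tens (upd h l x) + tens (upd h l y);
  tens_dot : forall h h', '<tens h, tens h'> = \prod_l '<h l, h' l>;
  tens_total : forall t, closed_span (hdot tpow) (range tens) t }.
End TensorPower.

Section SymmetricTensors.
Variables (K : numFieldType) (theta : K -> K) (H : hilbert theta) (n : nat).
Variable T : tensor_power H n.

(* symm (h_0 (x) ... (x) h_(n-1)) *)
Definition symm (h : 'I_n -> H) : T :=
  (n`!%:R)^-1 *: \sum_(s : 'S_n) tens T (h \o s).

Definition sym_power : set T := closed_span (hdot T) (range symm).

(* symm (h_0 (x) ... (x) h_(k-1)) (x) symm (h_k (x) ... (x) h_(n-1)):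
   the permutations s are those preserving {0, ..., k-1} *)
Definition split_symm (k : nat) (h : 'I_n -> H) : T :=
  ((k`! * (n - k)`!)%:R)^-1 *:
    \sum_(s : 'S_n | [forall l, (s l < k)%N == (l < k)%N]) tens T (h \o s).

Definition split_sym_power (k : nat) : set T :=
  closed_span (hdot T) (range (split_symm k)).
End SymmetricTensors.
Arguments sym_power {K theta H n} T _.
Arguments split_sym_power {K theta H n} T k _.

Lemma tens_linear_of_dot (K : numFieldType) (theta : {rmorphism K -> K})
    (H T : hilbert theta) (n : nat) (t : ('I_n -> H) -> T) :
  (forall h h', '<t h, t h'> = \prod_l '<h l, h' l>) ->
  forall h l (a : K) x y,
    t (upd h l (a *: x + y)) = a *: t (upd h l x) + t (upd h l y).
Proof.
move=> tdot h l a x y; apply/eqP; rewrite -subr_eq0; apply/eqP.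
apply: (@sqnorm_eq0 _ _ _ (hdot T)).
have dotl z h' : '<t (upd h l z), t h'> =
    '<z, h' l> * \prod_(m | m != l) '<h m, h' m>.
  rewrite tdot (bigD1 l) //= /upd eqxx; congr (_ * _).
  by apply: eq_bigr => m /negPf ->.
suff dot0 h' : '<t (upd h l (a *: x + y)) - (a *: t (upd h l x) + t (upd h l y)),
    t h'> = 0.
  by rewrite /sqnorm linearBr linearDr linearZr /= !dot0 mulr0 addr0 subr0.
rewrite linearBl linearDl linearZl_LR /= !dotl linearDl linearZl_LR /=.
by rewrite mulrDl mulrA subrr.
Qed.

Section MakeDot.
Variables (K : numFieldType) (theta : {rmorphism K -> K}) (V : lmodType K).
Variable f : V -> V -> K.
Hypothesis f_linear : forall z, GRing.linear_for *%R (f^~ z).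
Hypothesis f_herm : forall x y, f x y = theta (f y x).
Hypothesis f_pos : forall x, x != 0 -> 0 < f x x.

Definition mkdot_fun & (forall z, GRing.linear_for *%R (f^~ z)) &
  (forall x y, f x y = theta (f y x)) & (forall x, x != 0 -> 0 < f x x) := f.

Local Notation g := (mkdot_fun f_linear f_herm f_pos).

Let g_bilinear : bilinear_for (GRing.Scale.Law.clone _ _ *%R _)
  (GRing.Scale.Law.clone _ _ (theta \; *%R) _) g.
Proof.
split=> [z|z] a x y; first exact: f_linear.
by rewrite /mkdot_fun f_herm f_linear rmorphD rmorphM -!f_herm.
Qed.
HB.instance Definition _ :=
  bilinear_isBilinear.Build K V V K _ _ g g_bilinear.

Let g_herm x y : g x y = (-1) ^+ false * theta (g y x).
Proof. by rewrite expr0 mul1r; exact: f_herm. Qed.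
HB.instance Definition _ := isHermitianSesquilinear.Build K V false theta g g_herm.
HB.instance Definition _ := isDotProduct.Build K V g f_pos.

Definition mkdot : {dot V for theta} := g.
End MakeDot.

Section DirectSum.
Variables (R : realType) (H1 H2 : real_hilbert R).
Local Notation V := (H1 * H2)%type.

Definition dsum_fun (u v : V) : R := '<u.1, v.1> + '<u.2, v.2>.

Fact dsum_linear z : GRing.linear_for *%R (dsum_fun^~ z).
Proof.
by move=> a x y; rewrite /dsum_fun !linearDl !linearZl_LR /= mulrDr addrACA.
Qed.

Fact dsum_herm x y : dsum_fun x y = idfun (dsum_fun y x).
Proof.
by rewrite /dsum_fun; congr (_ + _); rewrite hermitian_subproof expr0 mul1r.
Qed.

Fact dsum_pos x : x != 0 -> 0 < dsum_fun x x.
Proof.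
move=> x0; rewrite lt_neqAle addr_ge0 ?(sqnorm_ge0 (hdot _))// andbT eq_sym.
apply: contra x0; rewrite paddr_eq0 ?(sqnorm_ge0 (hdot _))//.
move=> /andP[/eqP/(sqnorm_eq0 (dot := hdot _)) x1 /eqP/(sqnorm_eq0 (dot := hdot _)) x2].
by rewrite [x]surjective_pairing x1 x2.
Qed.

Definition dsum_dot : {dot V for idfun} := mkdot dsum_linear dsum_herm dsum_pos.

Fact dsum_complete u : hcauchy dsum_dot u -> exists v, hcvg dsum_dot u v.
Proof.
move=> cu.
have [v1 u1] : exists v, hcvg (hdot H1) (fun n => (u n).1) v.
  apply: hcomplete => e /cu[N uN]; exists N => m n Nm Nn.
  by rewrite (le_lt_trans _ (uN _ _ Nm Nn))// lerDl (sqnorm_ge0 (hdot _)).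
have [v2 u2] : exists v, hcvg (hdot H2) (fun n => (u n).2) v.
  apply: hcomplete => e /cu[N uN]; exists N => m n Nm Nn.
  by rewrite (le_lt_trans _ (uN _ _ Nm Nn))// lerDr (sqnorm_ge0 (hdot _)).
exists (v1, v2) => e e0; have e2 : 0 < e / 2 by rewrite divr_gt0.
have [N1 uN1] := u1 _ e2; have [N2 uN2] := u2 _ e2.
exists (maxn N1 N2) => n; rewrite geq_max => /andP[/uN1 ? /uN2 ?].
by rewrite (splitr e) ltrD.
Qed.

Definition dsum : real_hilbert R := Hilbert dsum_complete.
End DirectSum.

(* The complexification V + iV: the pair (f, g) stands for f + i g. *)
Definition cplx_of (R : realType) (V : lmodType R) : Type := (V * V)%type.
HB.instance Definition _ (R : realType) (V : lmodType R) :=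
  GRing.Zmodule.copy (cplx_of V) (V * V)%type.

Section Complexification.
Variable R : realType.

Definition cpair (V : lmodType R) (f g : V) : cplx_of V := (f, g).
Definition cre (V : lmodType R) (x : cplx_of V) : V := x.1.
Definition cim (V : lmodType R) (x : cplx_of V) : V := x.2.
Definition cconj (V : lmodType R) (x : cplx_of V) : cplx_of V := (x.1, - x.2).

Definition cscale (V : lmodType R) (c : R[i]) (x : cplx_of V) : cplx_of V :=
  (Re c *: x.1 - Im c *: x.2, Re c *: x.2 + Im c *: x.1).

Fact cscaleA (V : lmodType R) a b (x : cplx_of V) :
  cscale a (cscale b x) = cscale (a * b) x.
Proof.
case: a => a a'; case: b => b b'; case: x => x x'; rewrite /cscale /=.
congr pair; rewrite !scalerDr ?scalerN !scalerA !scalerDl ?scaleNr.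
  by rewrite -[LHS]addrA -[RHS]addrA -!opprD; congr (_ - _); rewrite addrA addrC.
by rewrite [X in _ + X]addrC addrACA.
Qed.

Fact cscale1 (V : lmodType R) : left_id 1 (@cscale V).
Proof. by case=> x x'; rewrite /cscale /= !scale1r !scale0r subr0 addr0. Qed.

Fact cscaleDr (V : lmodType R) : right_distributive (@cscale V) +%R.
Proof.
case=> a a' [x x'] [y y']; rewrite /cscale /=; congr pair => /=.
  by rewrite !scalerDr opprD addrACA.
by rewrite !scalerDr addrACA.
Qed.

Fact cscaleDl (V : lmodType R) (x : cplx_of V) :
  {morph (@cscale V)^~ x : a b / a + b}.
Proof.
case: x => x x' [a a'] [b b']; rewrite /cscale /=; congr pair => /=.
  by rewrite !scalerDl opprD addrACA.
by rewrite !scalerDl addrACA.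
Qed.

HB.instance Definition _ (V : lmodType R) :=
  GRing.Zmodule_isLmodule.Build R[i] (cplx_of V)
    (@cscaleA V) (@cscale1 V) (@cscaleDr V) (@cscaleDl V).

Variable H : real_hilbert R.

Definition cplx_fun (x y : cplx_of H) : R[i] :=
  (('<x.1, y.1> + '<x.2, y.2>) +i* ('<x.2, y.1> - '<x.1, y.2>))%C.

Fact cplx_linear z : GRing.linear_for *%R (cplx_fun^~ z).
Proof.
case: z => z z' [a a'] [x x'] [y y']; rewrite /cplx_fun /=.
rewrite !(linearDl, linearNl) /= !linearZl_LR /=.
by apply/eqP; rewrite eq_complex /=; apply/andP; split; apply/eqP; ring.
Qed.

Fact hdotC (x y : H) : '<x, y> = '<y, x>.
Proof. by rewrite hermitian_subproof expr0 mul1r. Qed.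

Fact cplx_herm x y : cplx_fun x y = conjc (cplx_fun y x).
Proof.
by rewrite /cplx_fun /= opprB; congr Complex; rewrite ![hdot _ x.1 _]hdotC
  ![hdot _ x.2 _]hdotC.
Qed.

Fact cplx_funxx x : cplx_fun x x = ('<x.1, x.1> + '<x.2, x.2>)%:C%C.
Proof. by rewrite /cplx_fun (hdotC x.2) subrr. Qed.

Fact cplx_pos x : x != 0 -> 0 < cplx_fun x x.
Proof.
by move=> x0; rewrite cplx_funxx ltcR; exact: (@dsum_pos _ H H x x0).
Qed.

Definition cplx_dot : {dot (cplx_of H) for conjc (R := R)} :=
  mkdot cplx_linear cplx_herm cplx_pos.

Fact sqnorm_cplx x : sqnorm cplx_dot x = (sqnorm (dsum_dot H H) x)%:C%C.
Proof. exact: cplx_funxx. Qed.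

Fact cplx_complete u : hcauchy cplx_dot u -> exists v, hcvg cplx_dot u v.
Proof.
move=> cu; have [|v uv] := @dsum_complete _ H H u.
  move=> e e0; have [|N uN] := cu e%:C%C; first by rewrite ltcR.
  exists N => m n Nm Nn; rewrite -ltcR; have := uN m n Nm Nn.
  by rewrite sqnorm_cplx.
exists v => -[e e'] e0; have /= [e'0 {}e0] := (andP (etrans (esym (ltcE _ _)) e0)).
rewrite /= in e'0; move/eqP: e'0 e0 => -> e0.
have [N uN] := uv e e0; exists N => n Nn.
by rewrite [ltLHS]sqnorm_cplx ltcR; exact: uN.
Qed.

Definition cplx : complex_hilbert R := Hilbert cplx_complete.
End Complexification.

(* With 0-based positions, the digit a_{j+1, l+1} of the binary expansion
   j = \sum_l a_{j+1, l+1} 2^l. *)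
Definition bit (j l : nat) : bool := odd (j %/ 2 ^ l).

Lemma bit_inj n j j' : (j < 2 ^ n)%N -> (j' < 2 ^ n)%N ->
  (forall l, (l < n)%N -> bit j l = bit j' l) -> j = j'.
Proof.
elim: n j j' => [|n IHn] j j'; first by rewrite expn0; case: j j' => // -[].
rewrite expnS => jn j'n jj'; have := jj' 0 isT; rewrite /bit expn0 !divn1 => odd_jj'.
rewrite -(odd_double_half j) -(odd_double_half j') odd_jj'.
rewrite (IHn j./2 j'./2) // -?divn2 ?ltn_divLR ?[(2 ^ n * 2)%N]mulnC //.
by move=> l ln; rewrite /bit -!divnMA -!expnS; exact: jj'.
Qed.

Lemma sum_prod_bit (R : comNzRingType) n (F : 'I_n -> bool -> R) :
  \sum_(j < 2 ^ n) \prod_(l < n) F l (bit j l) = \prod_(l < n) (F l false + F l true).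
Proof.
pose B (j : 'I_(2 ^ n)) := [ffun l : 'I_n => bit j l].
have Binj : injective B.
  move=> j j' /ffunP BB; apply/val_inj/(bit_inj (ltn_ord _) (ltn_ord _)) => l ln.
  by have := BB (Ordinal ln); rewrite !ffunE.
have Bbij : bijective B.
  by apply: inj_card_bij => //; rewrite card_ffun card_bool !card_ord.
under [RHS]eq_bigr => l _.
  rewrite (_ : _ + _ = \sum_(b : bool) F l b); last by rewrite big_bool addrC.
  over.
rewrite bigA_distr_bigA (reindex B) /=; last exact: onW_bij.
by apply: eq_bigr => j _; apply: eq_bigr => l _; rewrite ffunE.
Qed.

Section Columns.
Variables (R : realType) (H : real_hilbert R) (n : nat) (T : tensor_power H n).
Local Notation V := {ffun 'I_(2 ^ n) -> T}.

Definition col_fun (u v : V) : R := \sum_j '<u j, v j>.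

Fact col_linear z : GRing.linear_for *%R (col_fun^~ z).
Proof.
move=> a x y; rewrite /col_fun mulr_sumr -big_split /=; apply: eq_bigr => j _.
by rewrite !ffunE linearDl linearZl_LR.
Qed.

Fact col_herm x y : col_fun x y = idfun (col_fun y x).
Proof. by apply: eq_bigr => j _; exact: hdotC. Qed.

Fact col_pos x : x != 0 -> 0 < col_fun x x.
Proof.
have ge0 i : true -> 0 <= '<x i, x i> by move=> _; exact: (sqnorm_ge0 (hdot _)).
move=> x0; rewrite lt_neqAle sumr_ge0 // andbT eq_sym; apply: contra x0 => /eqP.
move=> /(psumr_eq0P ge0) xx0; apply/eqP/ffunP => j; rewrite ffunE.
by apply: (sqnorm_eq0 (dot := hdot _)); exact: xx0.
Qed.

Definition col_dot : {dot V for idfun} := mkdot col_linear col_herm col_pos.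

Fact sqnorm_col x : sqnorm col_dot x = \sum_j sqnorm (hdot T) (x j).
Proof. by []. Qed.

Fact col_complete u : hcauchy col_dot u -> exists v, hcvg col_dot u v.
Proof.
move=> cu.
have /fin_all_exists[v uv] : forall j, exists v, hcvg (hdot T) (fun m => u m j) v.
  move=> j; apply: hcomplete => e /cu[N uN]; exists N => m k Nm Nk.
  rewrite (le_lt_trans _ (uN _ _ Nm Nk))//.
  rewrite [leRHS]sqnorm_col (bigD1 j) //= !ffunE lerDl.
  by apply: sumr_ge0 => i _; exact: (sqnorm_ge0 (hdot _)).
exists [ffun j => v j] => e e0.
have p0 : 0 < ((2 ^ n)%N%:R : R) by rewrite ltr0n expn_gt0.
have /fin_all_exists[N uN] : forall j, exists N, forall m, (N <= m)%N ->
    sqnorm (hdot T) (u m j - v j) < e / (2 ^ n)%:R.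
  by move=> j; apply: uv; rewrite divr_gt0.
exists (\max_j N j)%N => m Nm.
have -> : e = \sum_(j < 2 ^ n) e / (2 ^ n)%:R.
  by rewrite sumr_const card_ord -[RHS]mulr_natr divfK // gt_eqF.
rewrite [ltLHS]sqnorm_col; apply: ltr_sum.
  by apply/hasP; exists (Ordinal (expn_gt0 2 n)) => //; rewrite mem_index_enum.
move=> j _; rewrite !ffunE; apply: uN; apply: leq_trans Nm.
exact: leq_bigmax.
Qed.

Definition col : real_hilbert R := Hilbert col_complete.

Definition col_tens (h : 'I_n -> dsum H H) : col :=
  [ffun j : 'I_(2 ^ n) => tens T (fun l => if bit j l then (h l).2 else (h l).1)].

Fact col_tens_dot h h' : '<col_tens h, col_tens h'> = \prod_l '<h l, h' l>.
Proof.
rewrite [LHS](_ : _ = \sum_j '<col_tens h j, col_tens h' j>) // -[RHS](@sum_prod_bit _ n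
  (fun l b => if b then '<(h l).2, (h' l).2> else '<(h l).1, (h' l).1>)).
apply: eq_bigr => j _; rewrite !ffunE tens_dot; apply: eq_bigr => l _.
by case: bit.
Qed.

Let single j (x : T) : col := [ffun j' => if j' == j then x else 0].

Fact col_tens_total t : closed_span (hdot col) (range col_tens) t.
Proof.
have -> : t = \sum_j single j (t j).
  apply/ffunP => j; rewrite sum_ffunE (bigD1 j) //= ffunE eqxx big1 ?addr0 //.
  by move=> i /negPf ij; rewrite ffunE eq_sym ij.
apply: closed_span_sum => j e e0.
have [_ [s sS ->] se] := tens_total (t j) e0.
exists (single j (\sum_(x <- s) x.1 *: x.2)); last first.
  rewrite [ltLHS]sqnorm_col (bigD1 j) //= !ffunE eqxx.
  rewrite [X in _ + X]big1 ?addr0 //.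
  by move=> i /negPf ij; rewrite !ffunE ij subr0 /sqnorm linear0l.
exists [seq (x.1, single j x.2) | x <- s].
  move=> _ /mapP[x xs ->] /=; have [h _ <-] := sS _ xs.
  exists (fun l : 'I_n => if bit j l then (0, h l) else (h l, 0)) => //.
  apply/ffunP => j'; rewrite !ffunE; case: eqP => [->|/eqP j'j].
    by congr tens; apply/funext => l; case: bit.
  have [l bl] : exists l : 'I_n, bit j' l != bit j l.
    apply: contrapT => /forallNP jj'; move/eqP: j'j; apply.
    apply/val_inj/(bit_inj (ltn_ord _) (ltn_ord _)) => l ln.
    by have /negP := jj' (Ordinal ln); rewrite negbK => /eqP.
  apply: (sqnorm_eq0 (dot := hdot _)); rewrite /sqnorm tens_dot (bigD1 l) //=.
  by move: bl; case: (bit j l); case: (bit j' l) => //= _; rewrite linear0l mul0r.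
rewrite big_map; apply/ffunP => j'; rewrite sum_ffunE ffunE.
case: eqP => [->|/eqP/negPf j'j]; last first.
  by rewrite big1 // => x _; rewrite !ffunE j'j scaler0.
by apply: eq_bigr => x _; rewrite !ffunE eqxx.
Qed.

(* The n-th tensor power of H (+) H as the space of columns of components. *)
Definition dsum_power : tensor_power (dsum H H) n :=
  TensorPower (tens_linear_of_dot (theta := idfun) col_tens_dot)
    col_tens_dot col_tens_total.
End Columns.

Section ComplexPower.
Variables (R : realType) (H : real_hilbert R) (n : nat) (T : tensor_power H n).

(* the complex multilinear extension of (f_l) |-> f_0 (x) ... (x) f_(n-1) *)
Definition cplx_tens (h : 'I_n -> cplx H) : cplx T :=
  \sum_(s : {ffun 'I_n -> bool}) (\prod_l (if s l then 'i%C else 1)) *: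
    cpair (tens T (fun l => if s l then cim (h l) else cre (h l))) 0.

Fact cplx_tens_dot h h' : '<cplx_tens h, cplx_tens h'> = \prod_l '<h l, h' l>.
Proof.
pose c (b : bool) : R[i] := if b then 'i%C else 1.
pose w (x : cplx H) (b : bool) := if b then cim x else cre x.
rewrite /cplx_tens linear_sumlz.
under [LHS]eq_bigr => s _.
  rewrite linear_sumr /=.
  under eq_bigr => s' _.
    rewrite linearZl_LR /= linearZr_LR /=.
    rewrite [X in _ * (_ * X)](_ : _ = \prod_l ('<w (h l) (s l), w (h' l) (s' l)>)%:C%C);
      last first.
      rewrite -rmorph_prod -(tens_dot T (fun l => w (h l) (s l))
        (fun l => w (h' l) (s' l))) [LHS]/(cplx_fun _ _) /cplx_fun /=.
      by rewrite !linear0r !linear0l /= subr0 addr0.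
    rewrite rmorph_prod -!big_split /=.
    over.
  rewrite -(bigA_distr_bigA (fun l b' => (if s l then 'i%C else 1) *
    (conjc (if b' then 'i%C else 1) * ('<w (h l) (s l), w (h' l) b'>)%:C%C))).
  over.
rewrite -(bigA_distr_bigA (fun l b => \sum_b' ((if b then 'i%C else 1) *
    (conjc (if b' then 'i%C else 1) * ('<w (h l) b, w (h' l) b'>)%:C%C)))).
apply: eq_bigr => l _; rewrite !big_bool /= [RHS]/(cplx_fun _ _) /cplx_fun.
rewrite /cre /cim; apply/eqP; rewrite eq_complex /=; apply/andP.
by split; apply/eqP; ring.
Qed.

Let cpair0_lin (s : seq (R * T)) :
  cpair (\sum_(x <- s) x.1 *: x.2) 0 = \sum_(x <- s) x.1%:C%C *: cpair x.2 0 :> cplx T.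
Proof.
elim: s => [|x s IHs]; first by rewrite !big_nil.
rewrite !big_cons -IHs; congr pair; rewrite /= ?scale0r ?subr0 //.
by rewrite scaler0 !addr0.
Qed.

Let real_total (z : R[i]) (x : T) : sqnorm (hdot (cplx T)) (z *: cpair x 0) =
  z * conjc z * (sqnorm (hdot T) x)%:C%C.
Proof.
rewrite /sqnorm linearZl_LR linearZr_LR /= mulrA; congr (_ * _).
by rewrite [LHS]/(cplx_fun _ _) /cplx_fun /= !linear0r !linear0l /= subr0 addr0.
Qed.

Let cplx_tens_real (h : 'I_n -> H) :
  cplx_tens (fun l => cpair (h l) 0) = cpair (tens T h) 0.
Proof.
rewrite /cplx_tens (bigD1 [ffun=> false]) //= [X in X *: _]big1; last first.
  by move=> l _; rewrite ffunE.
rewrite scale1r big1 ?addr0; first by congr cpair; congr tens; apply/funext => l; rewrite ffunE.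
move=> s s0; have [l sl] : exists l, s l.
  apply: contrapT => /forallNP sN; move/eqP: s0; apply; apply/ffunP => l.
  by rewrite ffunE; apply/negP.
rewrite (_ : tens T _ = 0) ?scaler0 //.
apply: (sqnorm_eq0 (dot := hdot _)); rewrite /sqnorm tens_dot (bigD1 l) //= sl.
by rewrite linear0l mul0r.
Qed.

Fact cplx_tens_total t : closed_span (hdot (cplx T)) (range cplx_tens) t.
Proof.
have real_span (z : R[i]) (x : T) : z * conjc z = 1 ->
    closed_span (hdot (cplx T)) (range cplx_tens) (z *: cpair x 0).
  move=> z1 -[e e'] e0.
  have /= [/eqP e'0 {}e0] := (andP (etrans (esym (ltcE _ _)) e0)).
  rewrite /= in e'0 e0; rewrite e'0.
  have [_ [s sS ->] se] := tens_total x e0.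
  exists (\sum_(x <- s) (z * x.1%:C%C) *: cpair x.2 0).
    exists [seq (z * y.1%:C%C, cpair y.2 0) | y <- s]; last by rewrite big_map.
    move=> _ /mapP[y ys ->] /=; have [h _ <-] := sS _ ys.
    by exists (fun l => cpair (h l) 0) => //; exact: cplx_tens_real.
  under eq_bigr do rewrite -scalerA.
  rewrite -scaler_sumr -cpair0_lin -scalerBr.
  rewrite (_ : cpair x 0 - cpair _ 0 = cpair (x - \sum_(y <- s) y.1 *: y.2) 0).
    by rewrite [ltLHS]real_total z1 mul1r ltcR.
  by congr pair; rewrite /= subr0.
have -> : t = 1 *: cpair t.1 0 + 'i%C *: cpair t.2 0.
  case: t => x y; rewrite scale1r; congr pair; rewrite /= scale0r scale1r.
    by rewrite subr0 addr0.
  by rewrite !add0r.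
apply: (@closed_spanD _ _ _ (hdot (cplx T))); apply: real_span; first by rewrite rmorph1 mulr1.
by rewrite -sqr_normc normc_def /= expr0n expr1n /= add0r sqrtr1 expr1n.
Qed.

(* The n-th tensor power of H_C as the complexification of that of H. *)
Definition cplx_power : tensor_power (cplx H) n :=
  TensorPower (tens_linear_of_dot (theta := @conjc R) cplx_tens_dot)
    cplx_tens_dot cplx_tens_total.
End ComplexPower.

Section GaussianProcesses.
Context {R : realType} {d : measure_display} {Omega : measurableType d}.
Variable P : probability Omega R.

(* s is the standard deviation; a constant is a degenerate Gaussian variable *)
Definition gaussian (Y : Omega -> R) :=
  exists m s : R, forall A : set R, measurable A ->
    P (Y @^-1` A) = if s == 0 then \d_m A else normal_prob m s A.

Definition gaussian_family (V : Type) (X : V -> Omega -> R) :=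
  forall (n : nat) (c : 'I_n -> R) (h : 'I_n -> V),
    gaussian (fun w => \sum_i c i * X (h i) w).

Record isonormal (H : real_hilbert R) (X : H -> {RV P >-> R}) : Prop := {
  isonormal_gaussian : gaussian_family X;
  isonormal_centered : forall h, ('E_P[X h] = 0)%E;
  isonormal_cov : forall h g, 'E_P[fun w => (X h w * X g w)%R]%E = ('<h, g>)%:E }.

Definition generated_sigma (V : Type) (X : V -> {RV P >-> R}) : set (set Omega) :=
  <<s [set E | exists h (B : set R), measurable B /\ E = X h @^-1` B] >>.

Definition independent_families (V V' : Type) (X : V -> {RV P >-> R})
    (Y : V' -> {RV P >-> R}) :=
  forall A B, generated_sigma X A -> generated_sigma Y B ->
    (P (A `&` B) = P A * P B)%E.

Section Processes.
Variables (H : real_hilbert R) (X Y : H -> {RV P >-> R}).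

Definition Wproc (h : dsum H H) : Omega -> R := fun w => X h.1 w + Y h.2 w.

Definition complexify (X' : H -> {RV P >-> R}) (h : cplx H) : Omega -> R[i] :=
  fun w => (X' (cre h) w +i* X' (cim h) w)%C.

Definition Zproc (h : cplx H) : Omega -> R[i] := fun w =>
  (complexify X h w + 'i%C * complexify Y h w) / (Num.sqrt 2)%:C%C.
End Processes.
End GaussianProcesses.

Section HermitePolynomials.
Variable R : realType.

Definition is_hermite (herm : nat -> R -> R) := forall t x : R,
  series (fun n => t ^+ n / n`!%:R * herm n x) @ \oo --> expR (t * x - t ^+ 2 / 2).

(* The double series is summed by increasing total degree p + q; its sum is
   real, lambda z^* + lambda^* z being 2 Re (lambda z^* ). *)
Definition is_complex_hermite (J : nat -> nat -> R[i] -> R[i]) :=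
  forall lambda z : R[i],
  let term p q := (lambda^* ^+ p * lambda ^+ q / (p`! * q`!)%:R * J p q z)%C in
  let S N := \sum_(0 <= n < N) \sum_(q < n.+1) term (n - q)%N q in
  let E := (lambda * z^* + lambda^* * z - 2 * (lambda * lambda^*))%C in
  Re (S N) @[N --> \oo] --> expR (Re E) /\ Im (S N) @[N --> \oo] --> (0 : R).
End HermitePolynomials.

Section MultiIndices.
Context {I : countType}.

Definition multi_index := {fsfun I -> nat with 0%N}.

Definition msize (m : multi_index) : nat := (\sum_(i <- finsupp m) m i)%N.

(* each index i repeated m i times; has length msize m *)
Definition mword (m : multi_index) : seq I :=
  flatten [seq nseq (m i) i | i <- finsupp m].
End MultiIndices.
Arguments multi_index : clear implicits.

Definition ord_fun (V : zmodType) (n : nat) (s : seq V) : 'I_n -> V :=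
  fun l => nth 0 s l.

Section WienerIntegrals.
Context {R : realType} {d : measure_display} {Omega : measurableType d}.
Variable P : probability Omega R.

Section Real.
Variables (herm : nat -> R -> R) (G : real_hilbert R) (W : G -> Omega -> R).

(* The closed linear subspace of L^2 generated by the herm n (W h), |h| = 1. *)
Definition wiener_chaos (n : nat) (F : Omega -> R) :=
  F \in Lfun P 2%:E /\
  forall e : R, 0 < e -> exists2 s : seq (R * G),
    {in s, forall x, '<x.2, x.2> = 1} &
    ('E_P[fun w => ((F w - \sum_(x <- s) x.1 * herm n (W x.2 w)) ^+ 2)%R] < e%:E)%E.

(* Int is only constrained on the symmetric tensors, its domain. *)
Record is_wiener_integral (I : countType) (eta : I -> G) (n : nat)
    (T : tensor_power G n) (Int : T -> Omega -> R) : Prop := {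
  wiener_L2 : forall g, sym_power T g -> Int g \in Lfun P 2%:E;
  wiener_linear : forall (a : R) g g', sym_power T g -> sym_power T g' ->
    {ae P, forall w, Int (a *: g + g') w = a * Int g w + Int g' w};
  wiener_isometry : forall g, sym_power T g ->
    'E_P[fun w => (Int g w ^+ 2)%R]%E = (n`!%:R * '<g, g>)%:E;
  wiener_basis : forall m : multi_index I, msize m = n ->
    {ae P, forall w, Int (symm T (ord_fun [seq eta i | i <- mword m])) w =
       \prod_(i <- finsupp m) herm (m i) (W (eta i) w)};
  wiener_onto : forall F, wiener_chaos n F <->
    exists2 g, sym_power T g & F \in Lfun P 2%:E /\ {ae P, forall w, F w = Int g w} }.
End Real.

Section Complex.
Variables (J : nat -> nat -> R[i] -> R[i]) (H : real_hilbert R).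
Variable Z : cplx H -> Omega -> R[i].

(* The integral I_{k, n-k}, on the closed subspace of the tensors that are
   symmetric in the first k and in the last n-k factors. *)
Record is_complex_integral (I : countType) (xi : I -> cplx H) (n k : nat)
    (T : tensor_power (cplx H) n) (Int : T -> Omega -> R[i]) : Prop := {
  complex_L2 : forall g, split_sym_power T k g ->
    (fun w => Re (Int g w)) \in Lfun P 2%:E /\
    (fun w => Im (Int g w)) \in Lfun P 2%:E;
  complex_linear : forall (a : R[i]) g g',
    split_sym_power T k g -> split_sym_power T k g' ->
    {ae P, forall w, Int (a *: g + g') w = a * Int g w + Int g' w};
  complex_isometry : forall g, split_sym_power T k g ->
    'E_P[fun w => (Re (Int g w) ^+ 2 + Im (Int g w) ^+ 2)%R]%E =
      ((k`! * (n - k)`!)%:R * Re '<g, g>)%:E;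
  complex_basis : forall m m' : multi_index I, msize m = k -> msize m' = (n - k)%N ->
    {ae P, forall w,
      Int (split_symm T k (ord_fun ([seq xi i | i <- mword m] ++
                                    [seq cconj (xi i) | i <- mword m']))) w =
      \prod_(i <- (finsupp m `|` finsupp m')%fset)
        ((Num.sqrt 2)%:C%C ^- (m i + m' i) *
         J (m i) (m' i) ((Num.sqrt 2)%:C%C * Z (xi i) w))} }.
End Complex.
End WienerIntegrals.

Section Coefficients.
Variables (R : realType) (p : nat).

(* b_{k,j+1}, c_{k,j+1} and V_{k,j+1}; the digits a_{j+1,1}, ..., a_{j+1,k} are
   those at the 0-based positions l < k. *)
Definition bcount (k : nat) (j : 'I_(2 ^ p)) : nat := (\sum_(l < p | (l < k)%N) bit j l)%N.
Definition ccount (k : nat) (j : 'I_(2 ^ p)) : nat := (\sum_(l < p | (k <= l)%N) bit j l)%N.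
Definition Vcoef (k : nat) (j : 'I_(2 ^ p)) : R[i] :=
  (- 'i%C) ^+ bcount k j * 'i%C ^+ ccount k j.

Variables (H : real_hilbert R) (T : tensor_power H p).

Definition Vsum (g1 g2 : dsum_power T) (k : nat) : cplx_power T :=
  \sum_(j < 2 ^ p) Vcoef k j *: (cpair (g1 j) (g2 j) : cplx_power T).
End Coefficients.

(* Main.v *)
(* Both integrals are computed on the tensors h^(x)p, h in H (+) H, which span
   the symmetric tensors by polarization.  The p-fold expansion of h over an
   orthonormal basis, combined with the recurrences of the Hermite polynomials,
   is a Wick formula, which gives I_p(h^(x)p) = K_p(|h|^2, W(h)) almost surely,
   where exp (t x - s t^2 / 2) = \sum_n t^n / n! K_n(s, x).  If h = (f, g) and
   u = f - i g, then \sum_j V_kj (h^(x)p)_j = u^(x)k (x) conj(u)^(x)(p - k), and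
   the same Wick formula, applied to an expansion of u over a basis of H_C with
   the two kinds of letters Z(xi_i) and conj(Z(xi_i)), gives
   \sum_k 2^(-p/2) 'C(p, k) I_(k, p-k)(u^(x)k (x) conj(u)^(x)(p - k)) =
   2^(-p/2) K_p(2 |u|^2, 2 Re Z(u)) = K_p(|h|^2, W(h)).  Hence
   I_p(g) = \sum_k I_(k, p-k)(2^(-p/2) 'C(p, k) \sum_j V_kj g_j) for all symmetric
   g, and under the hypothesis a single term survives.
   The finite expansions only give these identities for h in the span of each
   basis; as |h_n - h|^2 = O(2^-n) implies almost sure convergence of W(h_n) and
   of both integrals, they extend to all h. *)

Require Import Defs.
From HB Require Import structures.
From mathcomp Require Import all_boot all_order all_algebra all_fingroup.
From mathcomp Require Import finmap.
From mathcomp Require Import all_classical all_reals all_analysis.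
From mathcomp Require Import complex.
From mathcomp Require Import measurable_realfun.
From mathcomp Require Import ring lra.

Set Implicit Arguments.
Unset Strict Implicit.
Unset Printing Implicit Defensive.

Import Order.TTheory GRing.Theory Num.Theory.
Import numFieldNormedType.Exports.
Import complex.

Local Open Scope classical_set_scope.
Local Open Scope ring_scope.

(** * Power series and Hermite polynomials *)

(** The bases [eta] and [xi] are unrelated, so a vector with a finite expansion over one need not
    have a finite expansion over the other; this forces the comparison through an expression that
    mentions no basis, and a separate density argument for each side. Expansions are indexed by
    words rather than by multi-indices: multilinearity produces words directly, the first letter of
    a word drives the Hermite recurrence, and no multinomial coefficient has to be handled. All
    identities between integrals hold outside null sets that depend on the tensors, so they are only
    ever combined finitely or countably many at a time. The polynomials [J] are known only through a
    double series summed by total degree; they are recovered from the homogeneous parts of that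
    series, restricted to the unit circle. *)

Section PowerSeries.
Variable R : realType.
Implicit Types (f g : nat -> R) (x : R).

Lemma is_cvg_pseries_diffs f : (forall x, cvgn (pseries f x)) ->
  forall x, cvgn (pseries (pseries_diffs f) x).
Proof.
move=> fcvg x; apply: normed_cvg; rewrite /pseries.
(* The terms at r are bounded. Of the factor 4^(n+1), one 2^(n+1) absorbs the n+1 of the derivative
   and the other leaves a geometric ratio 1/2. *)
pose r := 4 * (`|x| + 1).
have r1 : 1 <= r.
  by rewrite /r mulrDr mulr1 (@le_trans _ _ 4) ?ler1n // lerDr mulr_ge0.
have r0 : 0 < r by rewrite (lt_le_trans ltr01).
have [K [Kreal /(_ (K + 1))]] := cvg_series_bounded (fcvg r).
rewrite ltrDl ltr01 => /(_ isT) Kf.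
apply: (@series_le_cvg _ _ (geometric (K + 1) (2^-1))) => [n|n|n|].
- exact: normr_ge0.
- by rewrite mulr_ge0 ?(le_trans _ (Kf 0%N I)).
- rewrite /pseries_diffs /= !normrM normr_nat normrX.
  have := Kf n.+1 I; rewrite /= normrM normrX (gtr0_norm r0) => fn.
  rewrite -(@ler_pM2r _ (r ^+ n.+1)) ?exprn_gt0 //.
  have -> : n.+1%:R * `|f n.+1| * `|x| ^+ n * r ^+ n.+1 =
    (`|f n.+1| * r ^+ n.+1) * (n.+1%:R * `|x| ^+ n) by ring.
  rewrite -[leRHS]mulrA ler_pM ?mulr_ge0 ?exprn_ge0 ?(ltW r0) //.
  have -> : 2^-1 ^+ n * r ^+ n.+1 = 2 ^+ n.+1 * (2 * (`|x| + 1) ^+ n.+1).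
    rewrite /r exprMn (_ : 4 = 2 * 2); last by rewrite -natrM.
    rewrite exprMn !exprS exprVn -!mulrA !mulrA; by field.
  apply: ler_pM; rewrite ?exprn_ge0 //.
    by rewrite -natrX ler_nat ltnW // ltn_expl.
  rewrite exprS mulrA (@le_trans _ _ (1 * (`|x| + 1) ^+ n)) //.
    by rewrite mul1r lerXn2r ?nnegrE ?addr_ge0 // lerDl.
  rewrite ler_wpM2r ?exprn_ge0 ?addr_ge0 //.
  by rewrite mulrDr mulr1 (@le_trans _ _ 2) ?ler1n // lerDr mulr_ge0.
- apply: is_cvg_geometric_series; rewrite ger0_norm // invf_lt1 ?ltr1n //.
Qed.

Lemma is_derive_pseries f x : (forall x, cvgn (pseries f x)) ->
  is_derive x 1 (fun y => limn (pseries f y)) (limn (pseries (pseries_diffs f) x)).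
Proof.
move=> fcvg; apply: (@pseries_snd_diffs _ _ (`|x| + 1)).
- exact: fcvg.
- exact: is_cvg_pseries_diffs.
- by do 2 apply: is_cvg_pseries_diffs.
by rewrite [ltRHS]ger0_norm ?addr_ge0 // ltrDl.
Qed.

Lemma pseries_at0 f : pseries f 0 @ \oo --> f 0%N.
Proof.
rewrite -cvg_shiftS; apply: cvg_near_cst; near=> n.
rewrite /pseries /series /= big_nat_recl //= expr0 mulr1 big1 ?addr0 // => i _.
by rewrite expr0n mulr0.
Unshelve. all: by end_near. Qed.

(** The value at 0 is the first coefficient; the derived series also sums to 0 everywhere and
    carries the later ones. *)
Lemma pseries_eq0 f : (forall x, pseries f x @ \oo --> (0 : R)) -> forall n, f n = 0.
Proof.
move=> f0 n; elim: n f f0 => [|n IHn] f f0.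
  exact: cvg_unique (@pseries_at0 f) (f0 0).
have fcvg x : cvgn (pseries f x) by apply/cvg_ex; exists 0.
have /IHn : forall x, pseries (pseries_diffs f) x @ \oo --> (0 : R).
  move=> x; have := is_derive_pseries x fcvg.
  rewrite (_ : (fun y => _) = cst 0); last first.
    by apply/funext => y; exact: cvg_lim.
  move=> D; have := @derive_val _ _ _ _ _ _ _ D; rewrite derive_cst => ->.
  exact: is_cvg_pseries_diffs.
by rewrite /pseries_diffs => /eqP; rewrite mulf_eq0 pnatr_eq0 /= => /eqP.
Qed.

Lemma pseries_inj f g (F : R -> R) :
  (forall x, pseries f x @ \oo --> F x) -> (forall x, pseries g x @ \oo --> F x) ->
  f =1 g.
Proof.
move=> fF gF n; apply/eqP; rewrite -subr_eq0; apply/eqP.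
apply: (@pseries_eq0 (fun n => f n - g n)) => x.
rewrite -[0](subrr (F x)).
rewrite (_ : pseries _ x = pseries f x - pseries g x); last first.
  apply/funext => m; rewrite !fctE /pseries /series /= -sumrN -big_split /=.
  by apply: eq_bigr => i _; rewrite mulrBl.
exact: cvgB.
Qed.
End PowerSeries.

(* [exp (t x - s t^2 / 2) = \sum_n t^n / n! scaled_hermite s x n] *)
Fixpoint scaled_hermite (K : nzRingType) (s x : K) (n : nat) : K :=
  match n with
  | 0%N => 1
  | 1%N => x
  | (m.+1 as n').+1 =>
      x * scaled_hermite s x n' - n'%:R * s * scaled_hermite s x m
  end.

Section ScaledHermite.

Lemma scaled_hermiteS (K : nzRingType) (s x : K) n :
  scaled_hermite s x n.+1 =
  x * scaled_hermite s x n - n%:R * s * scaled_hermite s x n.-1.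
Proof. by case: n => [|n] //=; rewrite mulr1 !mul0r subr0. Qed.

(** This is the substitution of c t for t in the generating function; with c = sqrt 2 it cancels the
    factor 2^(-p/2) of the decomposition. *)
Lemma scaled_hermiteM (K : comNzRingType) (s x c : K) n :
  scaled_hermite (c ^+ 2 * s) (c * x) n = c ^+ n * scaled_hermite s x n.
Proof.
elim/ltn_ind: n => -[|[|n]] IHn; rewrite ?expr0 ?mul1r ?expr1 //.
rewrite 2![scaled_hermite _ _ n.+2]scaled_hermiteS -pred_Sn !IHn // !exprS; ring.
Qed.

Lemma rmorph_scaled_hermite (K L : nzRingType) (f : {rmorphism K -> L}) s x n :
  f (scaled_hermite s x n) = scaled_hermite (f s) (f x) n.
Proof.
elim/ltn_ind: n => -[|[|n]] IHn; rewrite /= ?rmorph1 //.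
by rewrite -/(scaled_hermite s x n.+1) rmorphB !rmorphM rmorph_nat !IHn.
Qed.

(** For fixed x the generating function E(t) satisfies E'(t) = (x - t) E(t); comparing coefficients
    gives the three-term recurrence. *)
Lemma herm_scaled_hermite (R : realType) (herm : nat -> R -> R) :
  is_hermite herm -> forall n x, herm n x = scaled_hermite 1 x n.
Proof.
move=> hH n x.
pose a n : R := herm n x / n`!%:R.
have aE t : pseries a t @ \oo --> expR (t * x - t ^+ 2 / 2).
  rewrite /pseries (_ : (fun i => _) = fun n => t ^+ n / n`!%:R * herm n x).
    exact: hH.
  by apply/funext => i; rewrite /a; ring.
have acvg t : cvgn (pseries a t) by apply/cvg_ex; eexists; exact: aE.
have aD t : pseries (pseries_diffs a) t @ \oo --> (x - t) * expR (t * x - t ^+ 2 / 2).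
  have := is_derive_pseries t acvg.
  rewrite (_ : (fun y => _) = fun t => expR (t * x - t ^+ 2 / 2)); last first.
    by apply/funext => y; apply: cvg_lim => //; exact: aE.
  move=> D; have <- : limn (pseries (pseries_diffs a) t) =
      (x - t) * expR (t * x - t ^+ 2 / 2).
    rewrite -(@derive_val _ _ _ _ _ _ _ D) -derive1E derive1_comp //.
    rewrite (_ : (expR^`() _)%classic = expR (t * x - t ^+ 2 / 2)); last first.
      by rewrite derive1E; apply: derive_val.
    rewrite mulrC; congr (_ * _); rewrite derive1E.
    rewrite (_ : (fun y => _) = (id * cst x - (id ^+ 2) * cst 2^-1)%R) //.
    apply: derive_val; apply: trigger_derive; rewrite !fctE /GRing.scale /=. by field.
  exact: is_cvg_pseries_diffs.
(* The coefficients of (x - t) E(t): multiplication by t shifts [a] by one. *)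
pose b n : R := if n is m.+1 then x * a m.+1 - a m else x * a 0%N.
have bE t : pseries b t @ \oo --> (x - t) * expR (t * x - t ^+ 2 / 2).
  rewrite -cvg_shiftS mulrBl.
  rewrite (_ : (fun n => _) = fun n => x * pseries a t n.+1 - t * pseries a t n).
    apply: cvgB; apply: cvgMr; last exact: aE.
    by rewrite (cvg_shiftS (pseries a t)); exact: aE.
  apply/funext => m; rewrite /pseries /series /= !big_nat_recl //= !mulr_sumr.
  rewrite mulrDr mulr_sumr -!addrA -sumrN -big_split /= !mulrA; congr (_ + _).
  by apply: eq_bigr => i _; rewrite exprS; ring.
have ab m : m.+1%:R * a m.+1 = b m := pseries_inj aD bE m.
have fact_neq0 m : (m`!%:R : R) != 0 by rewrite pnatr_eq0 -lt0n fact_gt0.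
have aherm m : herm m x = a m * m`!%:R by rewrite divfK.
have a0 : a 0%N = 1.
  apply: (cvg_unique _ (@pseries_at0 _ a)) => //.
  by have := aE 0; rewrite mul0r expr0n /= mul0r subr0 expR0.
elim/ltn_ind: n => -[|[|n]] IHn.
- by rewrite aherm a0 fact0 mulr1.
- by rewrite aherm -[a 1%N]mul1r (ab 0%N) /= a0 !mulr1.
rewrite scaled_hermiteS -!IHn // !aherm /= mulr1 mulrA.
rewrite factS natrM mulrA [a n.+2 * _]mulrC ab /= [(n.+1)`!]factS natrM; ring.
Qed.
End ScaledHermite.

(** * Wick formula for sums over words *)

Section WeightedWords.
Variables (K : comNzRingType) (V : lmodType K) (A : Type).
Implicit Types (s : seq (K * A)) (F G : seq A -> V) (w : seq A).

(* the sum of c_1 ... c_n F [a_1; ...; a_n] over all (c_l, a_l) in s *)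
Fixpoint wsum s n F : V :=
  if n is m.+1 then \sum_(x <- s) x.1 *: wsum s m (fun w => F (x.2 :: w))
  else F [::].

Lemma eq_wsum s n F G : (forall w, size w = n -> F w = G w) ->
  wsum s n F = wsum s n G.
Proof.
elim: n F G => [|n IHn] F G FG /=; first exact: FG.
by apply: eq_bigr => x _; congr (_ *: _); apply: IHn => w wn; apply: FG; rewrite /= wn.
Qed.

Lemma wsumD s n F G : wsum s n (fun w => F w + G w) = wsum s n F + wsum s n G.
Proof.
elim: n F G => [|n IHn] F G //=; rewrite -big_split /=.
by apply: eq_bigr => x _; rewrite -scalerDr -IHn.
Qed.

Lemma wsumZ s n c F : wsum s n (fun w => c *: F w) = c *: wsum s n F.
Proof.
elim: n F => [|n IHn] F //=; rewrite scaler_sumr.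
by apply: eq_bigr => x _; rewrite IHn !scalerA mulrC.
Qed.

Lemma wsumB s n F G : wsum s n (fun w => F w - G w) = wsum s n F - wsum s n G.
Proof.
rewrite -scaleN1r -wsumZ -wsumD; apply: eq_wsum => w _; by rewrite scaleN1r.
Qed.

Variable kappa : A -> A -> K.

(* the sum over l of kappa i w_l times F (w without its l-th letter) *)
Fixpoint contract i F w : V :=
  if w is j :: w' then kappa i j *: F w' + contract i (fun v => F (j :: v)) w'
  else 0.

Lemma eq_contract i F G w : F =1 G -> contract i F w = contract i G w.
Proof. by move=> /funext ->. Qed.

(** Once all words are summed, the position of the deleted letter does not matter, so the n
    positions contribute equally. *)
Lemma wsum_contract s i n F : wsum s n (contract i F) =
  n%:R * (\sum_(y <- s) y.1 * kappa i y.2) *: wsum s n.-1 F.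
Proof.
elim: n F => [|n IHn] F /=; first by rewrite mul0r scale0r.
under eq_bigr => x _ do rewrite wsumD wsumZ IHn scalerDr [_ *: (kappa _ _ *: _)]scalerA.
rewrite big_split /= -scaler_suml -natr1 mulrDl mul1r scalerDl addrC.
congr (_ + _).
case: n {IHn} => [|n] /=.
  by rewrite mul0r scale0r big1 // => x _; rewrite scale0r scaler0.
by rewrite scaler_sumr; apply: eq_bigr => x _; rewrite !scalerA mulrC.
Qed.

End WeightedWords.

(** The second hypothesis is the recurrence of Wick products in their first letter. Summed over all
    words, [wsum_contract] turns it into the recurrence of [scaled_hermite], with the quadratic form
    of [kappa] as variance. *)
Lemma wick_wsum (K : comNzRingType) (A : Type) (kappa : A -> A -> K) (X : A -> K)
    (F : seq A -> K^o) (s : seq (K * A)) n : F [::] = 1 ->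
  (forall i w, F (i :: w) = X i * F w - contract kappa i F w) ->
  wsum s n F = scaled_hermite
    (\sum_(x <- s) \sum_(y <- s) x.1 * y.1 * kappa x.2 y.2)
    (\sum_(x <- s) x.1 * X x.2) n.
Proof.
move=> F0 FS; elim/ltn_ind: n => -[|n] IHn //.
rewrite scaled_hermiteS -IHn //.
have -> : (n%:R * (\sum_(x <- s) \sum_(y <- s) x.1 * y.1 * kappa x.2 y.2) *
    scaled_hermite (\sum_(x <- s) \sum_(y <- s) x.1 * y.1 * kappa x.2 y.2)
    (\sum_(x <- s) x.1 * X x.2) n.-1) =
    (n%:R * (\sum_(x <- s) \sum_(y <- s) x.1 * y.1 * kappa x.2 y.2) *
    wsum s n.-1 F).
  by case: n IHn => [|n] IHn; rewrite ?mul0r // IHn.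
rewrite /= mulr_suml mulr_sumr mulr_suml -sumrB; apply: eq_bigr => x _.
rewrite (@eq_wsum _ _ _ _ _ _ (fun w => (X x.2 *: F w) - contract kappa x.2 F w)) //.
rewrite wsumB wsumZ wsum_contract scalerBr [_ *: (_ *: _)]mulrA; congr (_ - _).
rewrite [LHS]mulrA; congr (_ * _); rewrite mulrCA; congr (_ * _).
by rewrite mulr_sumr; apply: eq_bigr => y _; rewrite mulrA.
Qed.

Section TwoAlphabets.
Variables (K : comNzRingType) (V : lmodType K) (A : Type) (s t : seq (K * A)).

Definition letters (b : bool) (w : seq (A * bool)) : seq A :=
  [seq x.1 | x <- w & x.2 == b].

Definition tagged_alphabet : seq (K * (A * bool)) :=
  [seq (x.1, (x.2, true)) | x <- s] ++ [seq (x.1, (x.2, false)) | x <- t].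

(** The summand sees only the two subwords, and subwords of lengths k and n - k can be interleaved
    in 'C(n, k) ways. The induction on the first letter is Pascal's rule. *)
Lemma wsum_two_alphabets n (F : seq A -> seq A -> V) :
  wsum tagged_alphabet n (fun w => F (letters true w) (letters false w)) =
  \sum_(k < n.+1) 'C(n, k)%:R *: wsum s k (fun v => wsum t (n - k) (F v)).
Proof.
elim: n F => [|n IHn] F; first by rewrite big_ord1 /= scale1r.
rewrite [LHS]/= /tagged_alphabet big_cat !big_map -/tagged_alphabet /=.
under eq_bigr => x _ do rewrite (IHn (fun v => F (x.2 :: v))) scaler_sumr.
rewrite exchange_big /=.
under [X in _ + X]eq_bigr => x _ do rewrite (IHn (fun v u => F v (x.2 :: u))) scaler_sumr.
rewrite [X in _ + X]exchange_big /=.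
pose G k l := wsum s k (fun v => wsum t l (F v)).
have GSl k l : \sum_(x <- s) x.1 *: wsum s k (fun v => wsum t l (F (x.2 :: v))) =
  G k.+1 l by [].
have GSr k l : \sum_(x <- t) x.1 *: wsum s k (fun v => wsum t l (fun u => F v (x.2 :: u))) =
  G k l.+1.
  rewrite /G /=; elim: k F {IHn G GSl} => [|k IHk] F //=.
  under eq_bigr => x _ do rewrite scaler_sumr.
  rewrite exchange_big /=; apply: eq_bigr => y _.
  rewrite -(IHk (fun v => F (y.2 :: v))) scaler_sumr.
  by apply: eq_bigr => x _; rewrite !scalerA mulrC.
under eq_bigr => k _.
  under eq_bigr => x _ do rewrite scalerA mulrC -scalerA.
  rewrite -scaler_sumr GSl; over.
under [X in _ + X]eq_bigr => k _.
  under eq_bigr => x _ do rewrite scalerA mulrC -scalerA.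
  rewrite -scaler_sumr GSr; over.
rewrite -[RHS]/(\sum_(k < n.+2) 'C(n.+1, k)%:R *: G k (n.+1 - k)%N).
rewrite [RHS]big_ord_recl.
have -> : \sum_(i < n.+1) 'C(n.+1, lift ord0 i)%:R *: G (lift ord0 i) (n.+1 - lift ord0 i)%N =
    \sum_(i < n.+1) 'C(n, i.+1)%:R *: G i.+1 (n - i)%N +
    \sum_(i < n.+1) 'C(n, i)%:R *: G i.+1 (n - i)%N.
  rewrite -big_split; apply: eq_bigr => i _.
  by rewrite lift0 binS natrD scalerDl subSS.
rewrite addrA [RHS]addrC; congr (_ + _).
rewrite big_ord_recl [in RHS]big_ord_recr /= (@bin_small n n.+1) // scale0r addr0.
rewrite !bin0 !subn0; congr (_ + _).
by apply: eq_bigr => i _; rewrite /bump /= subnSK.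
Qed.
End TwoAlphabets.

Lemma scale_regE (K : nzRingType) (u : K) (v : K^o) : u *: v = u * v.
Proof. by []. Qed.

(** * Wick products of letters grouped into independent classes *)

Section Contractions.
Variables (K : comNzRingType) (A : eqType).
Implicit Types (a j : A) (w : seq A).

Lemma eq_contract_in (V : lmodType K) (kappa kappa' : A -> A -> K) a
    (F : seq A -> V) w :
  {in w, kappa a =1 kappa' a} -> contract kappa a F w = contract kappa' a F w.
Proof.
elim: w F => [|j w IHw] F kk //=; rewrite kk ?mem_head // IHw // => i iw.
by rewrite kk // inE iw orbT.
Qed.

Lemma contract_size (s : K) (G : nat -> K^o) a w :
  contract (fun _ _ => s) a (fun w => G (size w)) w =
  (size w)%:R * s * G (size w).-1.
Proof.
elim: w G => [|j w IHw] G /=; first by rewrite !mul0r.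
rewrite (IHw (fun n => G n.+1)) -[in RHS]natr1 -/(size w) mulrDl mul1r mulrDl addrC.
by case: w {IHw} => [|i w] //=; rewrite !mul0r.
Qed.

(** Only letters of opposite tags contract, as Z and its conjugate do. The result is the correction
    term in the recurrences of [cherm]: in p for tag true, in q for tag false. *)
Lemma contract_count2 (s : K) (tag : A -> bool) (G : nat -> nat -> K^o) a w :
  contract (fun i j => s * (tag j != tag i)%:R) a
    (fun w => G (count tag w) (count (predC tag) w)) w =
  if tag a then (count (predC tag) w)%:R * s * G (count tag w) (count (predC tag) w).-1
  else (count tag w)%:R * s * G (count tag w).-1 (count (predC tag) w).
Proof.
elim: w G => [|j w IHw] G /=; first by rewrite !mul0r if_same.
rewrite (IHw (fun m n => G (tag j + m)%N (~~ tag j + n)%N)).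
rewrite scale_regE.
case: (tag a); case: (tag j); rewrite /= ?add0n ?add1n ?eqxx ?mulr0 ?mul0r ?add0r ?mulr1 //=.
  rewrite -natr1 mulrDl mul1r mulrDl addrC; congr (_ + _).
  by case: (count (predC tag) w) => [|n] //=; rewrite !mul0r.
rewrite -natr1 mulrDl mul1r mulrDl addrC; congr (_ + _).
by case: (count tag w) => [|n] //=; rewrite !mul0r.
Qed.

Section Classes.
Variables (I : eqType) (cl : A -> I) (kappa : A -> A -> K).
Hypothesis kappa0 : forall a j, cl a != cl j -> kappa a j = 0.

Definition class_part i w := [seq j <- w | cl j == i].

(** Letters outside the class of [a] do not contract with it, so the contraction acts on a single
    factor. *)
Lemma contract_prod (h : I -> seq A -> K^o) (S : seq I) a w : uniq S ->
  cl a \in S ->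
  contract kappa a (fun w => \prod_(i <- S) h i (class_part i w) : K^o) w =
  contract kappa a (h (cl a)) (class_part (cl a) w) *
    \prod_(i <- S | i != cl a) h i (class_part i w).
Proof.
move=> uS aS; elim: w h => [|j w IHw] h /=; first by rewrite mul0r.
(* The letter [j] just passed is stored in the factor of its class, which is why the induction is
   over all [h]. *)
pose h' i v : K^o := if cl j == i then h i (j :: v) else h i v.
rewrite (@eq_contract _ _ _ _ _ _ (fun v => \prod_(i <- S) h' i (class_part i v))); last first.
  by move=> v; apply: eq_bigr => i _; rewrite /h' /=; case: eqP.
rewrite {}IHw [X in _ + _ * X = _](eq_bigr (fun i => h i (class_part i (j :: w)))); last first.
  by move=> i _; rewrite /h' /=; case: eqP.
rewrite scale_regE /h' /=; have [ja|ja] /= := eqVneq (cl j) (cl a).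
  rewrite mulrDl; congr (_ + _).
  rewrite (bigD1_seq (cl a)) //= mulrA; congr (_ * _).
  by apply: eq_bigr => i ia; rewrite ja eq_sym (negPf ia).
by rewrite kappa0 1?eq_sym // mul0r add0r.
Qed.

Variables (g : I -> seq A -> K^o) (X : A -> K).
Hypothesis g_nil : forall i, g i [::] = 1.
Hypothesis g_cons : forall a w, {in w, forall j, cl j = cl a} ->
  g (cl a) (a :: w) = X a * g (cl a) w - contract kappa a (g (cl a)) w.

Definition class_prod w : K^o := \prod_(i <- undup (map cl w)) g i (class_part i w).

(** A class without letters contributes [g i [::] = 1], so all words in one recurrence can share an
    index set. *)
Lemma class_prodE (S : seq I) w : uniq S -> {subset map cl w <= S} ->
  class_prod w = \prod_(i <- S) g i (class_part i w).
Proof.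
move=> uS wS; rewrite [RHS](bigID (mem (map cl w))) /= [X in _ * X]big1 ?mulr1; last first.
  move=> i iw; rewrite (_ : class_part i w = [::]) ?g_nil //.
  apply/eqP; rewrite -size_eq0 size_filter -leqn0 leqNgt -has_count.
  by apply: contra iw => /hasP[j jw /eqP <-]; exact: map_f.
rewrite /class_prod -[RHS]big_filter; apply: perm_big.
apply: uniq_perm; rewrite ?undup_uniq ?filter_uniq // => i.
rewrite mem_undup mem_filter /=; case iw : (i \in map cl w) => //=.
by rewrite wS.
Qed.

Lemma class_prod_cons a w :
  class_prod (a :: w) = X a * class_prod w - contract kappa a class_prod w.
Proof.
pose S := undup (map cl (a :: w)).
have uS : uniq S by exact: undup_uniq.
have aS : cl a \in S by rewrite mem_undup mem_head.
have wS : {subset map cl w <= S}.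
  by move=> i iw; rewrite mem_undup /= inE iw orbT.
have contractE : contract kappa a class_prod w =
    contract kappa a (fun w => \prod_(i <- S) g i (class_part i w) : K^o) w.
  (* [contract] evaluates its function only on words with letters from [v], and there [class_prodE]
     applies. *)
  suff H v (F G : seq A -> K^o) : (forall u, {subset u <= v} -> F u = G u) ->
      contract kappa a F v = contract kappa a G v.
    apply: H => u uw; apply: class_prodE => // i /mapP[j ju ->].
    by apply/wS/map_f/uw.
  elim: v F G => [|j v IHv] F G FG //=; congr (_ *: _ + _).
    by apply: FG => i iv; rewrite inE iv orbT.
  by apply: IHv => u uv; apply: FG => i; rewrite !inE => /orP[->//|/uv ->]; rewrite orbT.
rewrite contractE contract_prod //.
rewrite (class_prodE (w := w) uS wS) (class_prodE (w := a :: w) uS) //; last first.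
  by move=> i; rewrite mem_undup.
rewrite !(bigD1_seq (cl a)) //= eqxx g_cons; last first.
  by move=> j; rewrite mem_filter => /andP[/eqP].
rewrite mulrBl mulrA; congr (_ * _ - _ * _); apply: eq_bigr => i ia //.
by rewrite eq_sym (negPf ia).
by rewrite eq_sym (negPf ia).
Qed.
End Classes.
End Contractions.

(** * Complex Hermite polynomials and their Wick formula *)

Section ComplexHermite.

(* [exp (lambda zb + mu z - s lambda mu) =
     \sum_(p, q) mu^p lambda^q / (p! q!) cherm s z zb p q] *)
Fixpoint cherm (K : comNzRingType) (s z zb : K) (p q : nat) : K :=
  if q is q'.+1 then zb * cherm s z zb p q' - p%:R * s * cherm s z zb p.-1 q'
  else z ^+ p.

(** [cherm] recurses on q; this mirror recurrence in p serves words that begin with an unconjugated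
    letter. *)
Lemma chermSl (K : comNzRingType) (s z zb : K) p q :
  cherm s z zb p.+1 q = z * cherm s z zb p q - q%:R * s * cherm s z zb p q.-1.
Proof.
elim: q p => [|q IHq] p; first by rewrite /= exprS !mul0r subr0.
have zJ : z * cherm s z zb p q = cherm s z zb p.+1 q + q%:R * s * cherm s z zb p q.-1.
  by rewrite IHq subrK.
(* Keeping the factor p makes the index [p.-1] harmless at p = 0; [qJ] does the same for q. *)
have pzJ : p%:R * (z * cherm s z zb p.-1 q) =
    p%:R * (cherm s z zb p q + q%:R * s * cherm s z zb p.-1 q.-1).
  by case: (p) => [|m]; rewrite ?mul0r //= IHq subrK.
have qJ : q%:R * cherm s z zb p q =
    q%:R * (zb * cherm s z zb p q.-1 - p%:R * s * cherm s z zb p.-1 q.-1).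
  by case: (q) => [|m]; rewrite ?mul0r.
rewrite [cherm s z zb p q.+1]/= [LHS]/= mulrBr mulrCA zJ.
rewrite [z * (_ * _)]mulrCA -[p%:R * s * (z * _)]mulrA [s * (z * _)]mulrCA.
have -> : p%:R * (z * (s * cherm s z zb p.-1 q)) = s * (p%:R * (z * cherm s z zb p.-1 q)).
  by ring.
have -> : q.+1%:R * s * cherm s z zb p q =
    s * (q%:R * cherm s z zb p q) + s * cherm s z zb p q.
  by ring.
rewrite pzJ qJ; ring.
Qed.

Lemma chermM (K : comNzRingType) (c s z zb : K) p q :
  cherm (c ^+ 2 * s) (c * z) (c * zb) p q = c ^+ (p + q) * cherm s z zb p q.
Proof.
elim: q p => [|q IHq] p; first by rewrite /= addn0 exprMn.
rewrite /= !IHq; case: p => [|p] /=; first by rewrite !mul0r !subr0 exprS; ring.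
by rewrite !addnS !addSn !exprS; ring.
Qed.

End ComplexHermite.

Section WickFormulas.
Variables (K : comNzRingType) (I : eqType).

(** Every letter is a class of its own: orthonormal letters contract only with themselves, with
    weight 1. *)
Lemma wsum_prod_hermite (x : I -> K) (s : seq (K * I)) n :
  wsum s n (fun w => \prod_(i <- undup w) scaled_hermite 1 (x i) (count_mem i w) : K^o) =
  scaled_hermite (\sum_(a <- s) \sum_(b <- s) a.1 * b.1 * (a.2 == b.2)%:R)
    (\sum_(a <- s) a.1 * x a.2) n.
Proof.
pose g i (w : seq I) : K^o := scaled_hermite 1 (x i) (size w).
pose kappa (i j : I) : K := (i == j)%:R.
rewrite -(@wick_wsum _ _ kappa x (class_prod id g)); first last.
- apply: class_prod_cons => // [i j /negPf ij|i w wi]; first by rewrite /kappa ij.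
  rewrite (eq_contract_in (kappa' := fun _ _ => 1)); last first.
    by move=> j /wi ->; rewrite /kappa eqxx.
  by rewrite contract_size /g -[size (i :: w)]/(size w).+1 scaled_hermiteS mulr1.
- by rewrite /class_prod big_nil.
apply: eq_wsum => w _; rewrite /class_prod map_id; apply: eq_bigr => i _.
by rewrite /g size_filter.
Qed.

(** A class consists of the letters [z i] (tag true) and [zb i] (tag false), which contract with
    each other with weight r. *)
Lemma wsum_prod_cherm (r : K) (z zb : I -> K) (s : seq (K * (I * bool))) n :
  wsum s n (fun w => \prod_(i <- undup (map fst w))
    cherm r (z i) (zb i) (count_mem i (letters true w))
      (count_mem i (letters false w)) : K^o) =
  scaled_hermite (\sum_(a <- s) \sum_(b <- s)
      a.1 * b.1 * (r * (b.2.2 != a.2.2)%:R * (a.2.1 == b.2.1)%:R))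
    (\sum_(a <- s) a.1 * (if a.2.2 then z a.2.1 else zb a.2.1)) n.
Proof.
pose g i (w : seq (I * bool)) : K^o :=
  cherm r (z i) (zb i) (count snd w) (count (predC snd) w).
pose kappa (i j : I * bool) : K := r * (j.2 != i.2)%:R * (i.1 == j.1)%:R.
pose X (a : I * bool) := if a.2 then z a.1 else zb a.1.
rewrite -(@wick_wsum _ _ kappa X (class_prod fst g)); first last.
- apply: class_prod_cons => // [i j /negPf ij|i w wi]; first by rewrite /kappa ij mulr0.
  rewrite (eq_contract_in (kappa' := fun i j => r * (snd j != snd i)%:R)); last first.
    by move=> j /wi ij; rewrite /kappa ij eqxx mulr1.
  rewrite (contract_count2 _ _ (cherm r (z i.1) (zb i.1))) /g /X.
  case: i wi => i [] /= wi; first by rewrite chermSl.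
  by [].
- by rewrite /class_prod big_nil.
apply: eq_wsum => w _; rewrite /class_prod; apply: eq_bigr => i _.
rewrite /g /letters !count_map !count_filter.
by apply: f_equal2; apply: eq_count => -[j []] /=; rewrite ?andbT ?andbF.
Qed.

Lemma sum_wsum_prod_cherm (r : K) (z zb : I -> K) (s t : seq (K * I)) n :
  \sum_(k < n.+1) 'C(n, k)%:R * wsum s k (fun v => wsum t (n - k) (fun u =>
    \prod_(i <- undup (v ++ u)) cherm r (z i) (zb i) (count_mem i v) (count_mem i u) : K^o)) =
  scaled_hermite (2 * r * \sum_(a <- s) \sum_(b <- t) a.1 * b.1 * (a.2 == b.2)%:R)
    (\sum_(a <- s) a.1 * z a.2 + \sum_(b <- t) b.1 * zb b.2) n.
Proof.
have := wsum_prod_cherm r z zb (tagged_alphabet s t) n.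
rewrite /tagged_alphabet [\sum_(a <- _ ++ _) a.1 * _]big_cat !big_map /=.
rewrite -/(tagged_alphabet s t).
(* Letters of equal tag do not contract, and each mixed pair occurs in both orders, hence the factor
   2. *)
rewrite [X in scaled_hermite X](_ : _ =
    2 * r * \sum_(a <- s) \sum_(b <- t) a.1 * b.1 * (a.2 == b.2)%:R); last first.
  rewrite /tagged_alphabet big_cat !big_map /=.
  under eq_bigr => a _.
    rewrite big_cat !big_map /= [X in X + _]big1 ?add0r; last by move=> b _; ring.
    over.
  under [X in _ + X]eq_bigr => a _.
    rewrite big_cat !big_map /= [X in _ + X]big1 ?addr0; last by move=> b _; ring.
    over.
  rewrite [X in _ + X]exchange_big /= mulr_sumr -big_split /=; apply: eq_bigr => a _.
  rewrite mulr_sumr -big_split /=; apply: eq_bigr => b _.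
  by rewrite [b.2 == _]eq_sym; ring.
move=> <-; rewrite -[LHS](wsum_two_alphabets s t n (fun v u =>
  \prod_(i <- undup (v ++ u)) cherm r (z i) (zb i) (count_mem i v) (count_mem i u) : K^o)).
apply: eq_wsum => w _; apply: perm_big; apply: uniq_perm; rewrite ?undup_uniq // => i.
rewrite !mem_undup mem_cat; apply/orP/idP => [|/mapP[[j b] jw ->]].
  by case=> /mapP[j]; rewrite mem_filter => /andP[_ jw] ->; exact: map_f.
by case: b jw => jw; [left|right]; apply/mapP; [exists (j, true)|exists (j, false)];
  rewrite // mem_filter jw.
Qed.
End WickFormulas.

(** The Wick formula over a one-letter alphabet; it evaluates the homogeneous forms from which [J]
    is identified. *)
Lemma sum_cherm (K : comNzRingType) (r z zb a b : K) n :
  \sum_(k < n.+1) 'C(n, k)%:R * (a ^+ k * b ^+ (n - k) * cherm r z zb k (n - k)) =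
  scaled_hermite (2 * r * (a * b)) (a * z + b * zb) n.
Proof.
have wsum1 c m (F : seq unit -> K^o) : wsum [:: (c, tt)] m F = c ^+ m * F (nseq m tt).
  elim: m F => [|m IHm] F /=; first by rewrite mul1r.
  by rewrite big_seq1 IHm scale_regE exprS mulrA.
have := @sum_wsum_prod_cherm K unit r (fun=> z) (fun=> zb) [:: (a, tt)] [:: (b, tt)] n.
rewrite !big_seq1 mulr1 => <-; apply: eq_bigr => k _; congr (_ * _).
rewrite wsum1 wsum1 mulrA; congr (_ * _).
have kn : (k <= n)%N by rewrite -ltnS.
have [n0|n0] := posnP n.
  have k0 : (k : nat) = 0%N by apply/eqP; rewrite -leqn0 -[leqRHS]n0.
  by rewrite k0 n0 big_nil.
rewrite (@perm_big _ _ _ _ _ [:: tt]).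
  by rewrite big_seq1 !count_nseq !mul1n.
apply: uniq_perm; rewrite ?undup_uniq // => -[].
rewrite mem_undup mem_cat !mem_nseq !eqxx !andbT mem_head.
by rewrite subn_gt0 lt0n; case: eqP => // ->.
Qed.

(** * Identification of J from its generating function *)

Section ComplexHermiteUnique.
Variable R : realType.
Local Notation C := R[i].

Lemma conjc_realM (a : R) (z : C) : conjc (a%:C%C * z) = a%:C%C * conjc z.
Proof.
by case: z => x y; apply/eqP; rewrite eq_complex /=; apply/andP; split; apply/eqP; ring.
Qed.

Lemma poly_nat_roots_eq0 (F : fieldType) (p : {poly F}) (r : nat -> F) :
  injective r -> (forall t, root p (r t)) -> p = 0.
Proof.
move=> rI pr; apply/eqP/negPn/negP => p0.
have := max_poly_roots (rs := map r (iota 0 (size p))) p0.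
rewrite map_inj_uniq // iota_uniq size_map size_iota ltnn => H.
suff : false by []; apply: H => //.
by apply/allP => _ /mapP[t _ ->].
Qed.

(** Divided by mu^n, the form is a polynomial in conj(mu) / mu, which takes infinitely many values
    on the circle. *)
Lemma conj_homogeneous_eq0 n (d : nat -> C) :
  (forall mu : C, mu * conjc mu = 1 ->
     \sum_(k < n.+1) conjc mu ^+ k * mu ^+ (n - k) * d k = 0) ->
  forall k, (k <= n)%N -> d k = 0.
Proof.
move=> d0 k kn.
(* The ratios (1 - i t) / (1 + i t) are distinct, and they do not change when the real factor [c]
   below brings [nu t] to modulus 1. *)
pose nu (t : nat) : C := (1 +i* t%:R)%C.
have nuV t : nu t * conjc (nu t) = (1 + t%:R ^+ 2)%:C%C.
  by apply/eqP; rewrite eq_complex /=; apply/andP; split; apply/eqP; ring.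
have nu0 t : nu t != 0 by rewrite eq_complex /= oner_eq0.
have nuc0 t : conjc (nu t) != 0 by rewrite fmorph_eq0.
pose r t := conjc (nu t) / nu t.
have rI : injective r.
  move=> t u; rewrite /r => /eqP; rewrite eqr_div // => /eqP.
  move=> /(congr1 (fun z => complex.Im z)) /=; rewrite !mulr1 !mul1r => /eqP.
  rewrite -subr_eq0 (_ : _ - _ = 2 * (u%:R - t%:R)); last by ring.
  by rewrite mulf_eq0 pnatr_eq0 /= subr_eq0 eqr_nat => /eqP.
pose p := \poly_(j < n.+1) d j.
have p0 : p = 0.
  apply: (@poly_nat_roots_eq0 _ p r) => // t; rewrite /root horner_poly.
  pose c : C := ((Num.sqrt (1 + t%:R ^+ 2))^-1)%:C%C.
  have s0 : 0 < 1 + t%:R ^+ 2 :> R by rewrite ltr_pwDl // sqr_ge0.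
  have c0 : c != 0.
    by rewrite /c fmorph_eq0 invr_eq0 gt_eqF // sqrtr_gt0.
  have := d0 (c * nu t).
  rewrite conjc_realM mulrACA nuV -!rmorphM -invfM -expr2.
  rewrite (sqr_sqrtr (ltW s0)) mulVf ?(gt_eqF s0) // => /(_ erefl) H.
  apply/eqP; have : (c * nu t) ^+ n != 0 by rewrite expf_neq0 // mulf_neq0.
  move=> /mulfI; apply; rewrite mulr0 -[RHS]H mulr_sumr; apply: eq_bigr => j _.
  have jn : (j <= n)%N by rewrite -ltnS.
  rewrite -{1}(subnK jn) exprD /r !exprMn !exprVn -/c.
  have nuj : nu t ^+ j != 0 by rewrite expf_neq0.
  by field.
have := coef_poly n.+1 d k; rewrite -/p p0 coef0 ltnS kn => <-//.
Qed.

(** Put lambda = t mu with t real and |mu| = 1. Grouped by total degree, the series is a power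
    series in t for exp(2 t x - 2 t^2), x = Re(mu conj(z)), so its n-th coefficient, a form in mu
    and conj(mu), equals 2^n H_n(x) / n!. By [sum_cherm] the form built from [cherm 2] has the same
    value, and [conj_homogeneous_eq0] separates the coefficients. *)
Lemma complex_hermiteE (herm : nat -> R -> R) (J : nat -> nat -> C -> C) :
  is_hermite herm -> is_complex_hermite J ->
  forall p q z, J p q z = cherm 2 z (conjc z) p q.
Proof.
move=> hH hJ p q z.
pose n := (p + q)%N.
have fact0 m : (m`!%:R : C) != 0 by rewrite pnatr_eq0 -lt0n fact_gt0.
suff : forall k, (k <= n)%N ->
    (J k (n - k)%N z - cherm 2 z (conjc z) k (n - k)) / (k`! * (n - k)`!)%:R = 0.
  move=> /(_ p (leq_addr _ _)) /eqP; rewrite /n addKn mulf_eq0 invr_eq0 natrM mulf_eq0.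
  by rewrite !(negPf (fact0 _)) !orbF subr_eq0 => /eqP.
apply: conj_homogeneous_eq0 => mu mu1.
pose Q m := \sum_(k < m.+1)
  conjc mu ^+ (m - k) * mu ^+ k / ((m - k)`! * k`!)%:R * J (m - k)%N k z.
pose x : R := Re (mu * conjc z).
have xE : 2 * x%:C%C = conjc mu * z + mu * conjc z.
  rewrite /x; case: (mu) (z) => [a b] [c d].
  by apply/eqP; rewrite eq_complex /=; apply/andP; split; apply/eqP; ring.
have Q_hermite : Q n = (2 ^+ n / n`!%:R * herm n x)%:C%C.
  pose E t : R := expR (t * (2 * x) - 2 * t ^+ 2).
  pose S t N := \sum_(0 <= m < N) \sum_(l < m.+1)
    (t%:C%C * mu)^*%C ^+ (m - l) * (t%:C%C * mu) ^+ l / ((m - l)`! * l`!)%:R * J (m - l)%N l z.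
  have QE t N : S t N = \sum_(0 <= m < N) t%:C%C ^+ m * Q m.
    apply: eq_bigr => m _; rewrite mulr_sumr; apply: eq_bigr => l _.
    rewrite conjc_realM !exprMn.
    have lm : (l <= m)%N by rewrite -ltnS.
    have -> : t%:C%C ^+ m = t%:C%C ^+ (m - l) * t%:C%C ^+ l by rewrite -exprD subnK.
    by ring.
  have expE t : Re ((t%:C%C * mu) * conjc z + conjc (t%:C%C * mu) * z -
      2 * ((t%:C%C * mu) * conjc (t%:C%C * mu)))
     = t * (2 * x) - 2 * t ^+ 2.
    rewrite (_ : (_ - _)%R = (t * (2 * x) - 2 * t ^+ 2)%:C%C) //.
    rewrite conjc_realM rmorphB !rmorphM !rmorph_nat xE.
    rewrite (_ : _ * _ * (_ * _) = t%:C%C ^+ 2 * (mu * conjc mu)); last by ring.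
    by rewrite mu1 mulr1; ring.
  have Re_sum N (F : nat -> C) : Re (\sum_(0 <= m < N) F m) = \sum_(0 <= m < N) Re (F m).
    exact: raddf_sum.
  have Im_sum N (F : nat -> C) : Im (\sum_(0 <= m < N) F m) = \sum_(0 <= m < N) Im (F m).
    exact: raddf_sum.
  have ReE t : pseries (fun m => Re (Q m)) t @ \oo --> E t.
    have [+ _] := hJ (t%:C%C * mu) z; rewrite expE => H.
    rewrite (_ : pseries _ t = fun N => Re (S t N)); first exact: H.
    apply/funext => N; rewrite /pseries /series /= QE Re_sum; apply: eq_bigr => m _.
    rewrite -rmorphXn /=; case: (Q m) => a b /=; ring.
  have ImE t : pseries (fun m => Im (Q m)) t @ \oo --> (0 : R).
    have [_ H] := hJ (t%:C%C * mu) z.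
    rewrite (_ : pseries _ t = fun N => Im (S t N)); first exact: H.
    apply/funext => N; rewrite /pseries /series /= QE Im_sum; apply: eq_bigr => m _.
    rewrite -rmorphXn /=; case: (Q m) => a b /=; ring.
  have hE t : pseries (fun m => 2 ^+ m / m`!%:R * herm m x) t @ \oo --> E t.
    have := hH (2 * t) x.
    rewrite (_ : 2 * t * x - (2 * t) ^+ 2 / 2 = t * (2 * x) - 2 * t ^+ 2); last by field.
    rewrite (_ : (fun n => _) = fun i => 2 ^+ i / i`!%:R * herm i x * t ^+ i) //.
    by apply/funext => i; rewrite exprMn; ring.
  apply/eqP; rewrite eq_complex; apply/andP; split; apply/eqP.
    exact: (pseries_inj ReE hE).
  exact: (pseries_eq0 ImE).
have Q_cherm : n`!%:R^-1 * (\sum_(k < n.+1) 'C(n, k)%:R *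
   (conjc mu ^+ k * mu ^+ (n - k) * cherm 2 z (conjc z) k (n - k))) =
   (2 ^+ n / n`!%:R * herm n x)%:C%C.
  rewrite sum_cherm (herm_scaled_hermite hH) -xE [conjc mu * mu]mulrC mu1.
  rewrite (_ : 2 * 2 * 1 = 2 ^+ 2 * 1) // scaled_hermiteM.
  rewrite !rmorphM /= fmorphV rmorph_nat rmorphXn rmorph_nat rmorph_scaled_hermite rmorph1.
  by ring.
rewrite (eq_bigr (fun k : 'I_n.+1 =>
   conjc mu ^+ k * mu ^+ (n - k) / (k`! * (n - k)`!)%:R * J k (n - k)%N z -
   n`!%:R^-1 * ('C(n, k)%:R *
     (conjc mu ^+ k * mu ^+ (n - k) * cherm 2 z (conjc z) k (n - k))))); last first.
  move=> k _; have kn : (k <= n)%N by rewrite -ltnS.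
  have := fact0 n; rewrite -(bin_fact kn) !natrM => n0.
  have c0 : ('C(n, k)%:R : C) != 0 by move: n0; rewrite mulf_eq0 negb_or => /andP[].
  have := fact0 k; have := fact0 (n - k)%N => nk0 k0.
  by field; rewrite c0 nk0 k0.
rewrite sumrB -mulr_sumr Q_cherm -Q_hermite /Q; apply/eqP; rewrite subr_eq0; apply/eqP.
(* [Q] is indexed by the power of mu, the other sum by the power of its conjugate. *)
rewrite (reindex_inj rev_ord_inj) /=; apply: eq_bigr => k _.
have kn : (k <= n)%N by rewrite -ltnS.
by rewrite subSS subKn.
Qed.
End ComplexHermiteUnique.

(** * Symmetric tensors *)

Section ClosedSpan.
Context {K : numFieldType} {theta : K -> K} {V : lmodType K}.
Variable dot : {dot V for theta}.
Implicit Types S : set V.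

Lemma sqnormZ a v : sqnorm dot (a *: v) = a * theta a * sqnorm dot v.
Proof. by rewrite /sqnorm linearZl_LR linearZr_LR /= mulrA. Qed.

Lemma sqnormN v : sqnorm dot (- v) = sqnorm dot v.
Proof. by rewrite /sqnorm linearNl linearNr opprK. Qed.

Lemma sqnormB_le u v w :
  sqnorm dot (u - w) <= (sqnorm dot (u - v) + sqnorm dot (v - w)) *+ 2.
Proof. by rewrite -[u - w](subrKA v) sqnormD_le. Qed.

(** Iterating the two-term bound gives a crude constant, enough for the boundedness of the finite
    sum [Vsum]. *)
Lemma sqnorm_sum_le (I : Type) (r : seq I) (F : I -> V) :
  sqnorm dot (\sum_(i <- r) F i) <= 2 ^+ size r * \sum_(i <- r) sqnorm dot (F i).
Proof.
elim: r => [|i r IHr]; first by rewrite !big_nil mulr0 /sqnorm linear0l.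
rewrite !big_cons exprS (le_trans (sqnormD_le _ _ _)) // -[leLHS]mulr_natl -mulrA.
rewrite ler_pM2l ?ltr0n // mulrDr lerD //.
by rewrite ler_peMl ?sqnorm_ge0 // exprn_ege1 // ler1n.
Qed.

Lemma closed_spanZ S a v : closed_span dot S v -> closed_span dot S (a *: v).
Proof.
(* [theta] is an arbitrary map, so [a * theta a] has no known sign, only its product with a squared
   norm; hence the absolute value. The 1 covers a = 0. *)
move=> Sv e e0; pose c := `|a * theta a| + 1.
have c0 : 0 < c by rewrite ltr_wpDl.
have [_ [s sS ->] sv] := Sv (e / c) (divr_gt0 e0 c0).
exists (\sum_(x <- s) (a * x.1) *: x.2).
  exists [seq (a * x.1, x.2) | x <- s]; last by rewrite big_map.
  by move=> _ /mapP[x xs ->] /=; exact: (sS _ xs).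
under eq_bigr do rewrite -scalerA.
rewrite -scaler_sumr -scalerBr sqnormZ.
set x := sqnorm _ _ in sv *.
have x0 : 0 <= x by exact: sqnorm_ge0.
have ax0 : 0 <= a * theta a * x by rewrite -sqnormZ sqnorm_ge0.
rewrite -(ger0_norm ax0) normrM (ger0_norm x0).
rewrite (@le_lt_trans _ _ (c * x)) ?ler_wpM2r ?lerDl //.
by rewrite mulrC -ltr_pdivlMr.
Qed.

Lemma closed_span_le S S' : S `<=` closed_span dot S' ->
  closed_span dot S `<=` closed_span dot S'.
Proof.
move=> SS' v Sv e e0; have e4 : 0 < e / 4 by rewrite divr_gt0.
have [w [s sS ->] sv] := Sv _ e4; set u := \sum_(x <- s) _ in sv.
have : closed_span dot S' u.
  rewrite /u big_seq; elim/big_rec: _ => [|x y xs Sy]; first exact: closed_span0.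
  by apply: closed_spanD => //; apply/closed_spanZ/SS'/(sS _ xs).
move=> /(_ _ e4)[t S't tu]; exists t => //.
rewrite (le_lt_trans (sqnormB_le _ u _)) //.
rewrite [ltRHS](_ : _ = (e / 4 + e / 4) *+ 2); last by field.
by rewrite ltrMn2r /= ltrD.
Qed.

Lemma lin_span_range (I : Type) (f : I -> V) v : lin_span (range f) v ->
  exists t : seq (K * I), v = \sum_(x <- t) x.1 *: f x.2.
Proof.
move=> [s sS ->]; elim: s sS => [|x s IHs] sS; first by exists [::]; rewrite !big_nil.
have [|t tE] := IHs; first by move=> y ys; apply: sS; rewrite inE ys orbT.
have [i _ ix] := sS x (mem_head _ _).
by exists ((x.1, i) :: t); rewrite !big_cons tE -ix.
Qed.

Lemma sub_closed_span S : S `<=` closed_span dot S.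
Proof.
move=> v Sv e e0; exists v; last by rewrite subrr /sqnorm linear0l.
by exists [:: (1, v)]; [move=> x; rewrite inE => /eqP ->|rewrite big_seq1 scale1r].
Qed.
End ClosedSpan.

(** * Multilinear expansion over words *)

Section Multilinear.
Variables (K : numFieldType) (theta : K -> K) (H : hilbert theta) (n : nat).
Implicit Types (h : 'I_n -> H) (l : 'I_n).

Definition multilinear (V : lmodType K) (M : ('I_n -> H) -> V) :=
  forall h l (a : K) x y,
    M (upd h l (a *: x + y)) = a *: M (upd h l x) + M (upd h l y).

Lemma ord_fun_upd (r t : seq H) (x : H) (rn : (size r < n)%N) :
  ord_fun (r ++ x :: t) = upd (ord_fun (r ++ 0 :: t)) (Ordinal rn) x.
Proof.
apply/funext => l; rewrite /upd /ord_fun !nth_cat; case: eqP => [->|lr] /=.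
  by rewrite ltnn subnn.
case: ltnP => // rl; case: (ltngtP (size r) l) rl => // [rl _|rl _].
  by rewrite -(subnSK rl).
by case: lr; apply: val_inj.
Qed.

Lemma multilinear_sum (V : lmodType K) (M : ('I_n -> H) -> V) (I : Type)
    (r t : seq H) (s : seq (K * I)) (f : I -> H) : multilinear M ->
  (size r < n)%N ->
  M (ord_fun (r ++ (\sum_(x <- s) x.1 *: f x.2) :: t)) =
  \sum_(x <- s) x.1 *: M (ord_fun (r ++ f x.2 :: t)).
Proof.
move=> ML rn.
have M0 : M (ord_fun (r ++ 0 :: t)) = 0.
  apply: (addrI (M (ord_fun (r ++ 0 :: t)))); rewrite addr0.
  by have := ML (ord_fun (r ++ 0 :: t)) (Ordinal rn) 1 0 0;
    rewrite scaler0 addr0 -!(ord_fun_upd _ _ rn) scale1r.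
elim: s => [|x s IHs]; first by rewrite !big_nil.
by rewrite !big_cons -IHs [in LHS](ord_fun_upd _ _ rn) ML -!(ord_fun_upd _ _ rn).
Qed.

(** [r] holds the slots already expanded, so the induction on m proceeds from left to right. *)
Lemma multilinear_wsum (V : lmodType K) (M : ('I_n -> H) -> V) (I : Type)
    (r t : seq H) (s : seq (K * I)) (f : I -> H) m : multilinear M ->
  (size r + m <= n)%N ->
  M (ord_fun (r ++ nseq m (\sum_(x <- s) x.1 *: f x.2) ++ t)) =
  wsum s m (fun w => M (ord_fun (r ++ map f w ++ t))).
Proof.
move=> ML; elim: m r => [|m IHm] r rm //=.
rewrite multilinear_sum //; last by rewrite (leq_trans _ rm) // addnS ltnS leq_addr.
apply: eq_bigr => x _; congr (_ *: _).
rewrite -cat_rcons IHm; last by rewrite size_rcons addSnnS.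
by apply: eq_wsum => w _; rewrite cat_rcons.
Qed.

Variable T : tensor_power H n.

Lemma multilinear_perm_sum (P : pred 'S_n) :
  multilinear (fun h => \sum_(s | P s) tens T (h \o s)).
Proof.
move=> h l a x y; rewrite scaler_sumr -big_split /=; apply: eq_bigr => s _.
have upd_perm z : upd h l z \o s = upd (h \o s) ((s^-1)%g l) z.
  apply/funext => m; rewrite /upd /=; congr (if _ then _ else _).
  by apply/eqP/eqP => [<-|->]; rewrite ?permK ?permKV.
by rewrite !upd_perm tens_linear.
Qed.

Lemma multilinearZ (V : lmodType K) (M : ('I_n -> H) -> V) c : multilinear M ->
  multilinear (fun h => c *: M h).
Proof. by move=> ML h l a x y; rewrite ML scalerDr !scalerA mulrC. Qed.

Lemma multilinear_symm : multilinear (symm T).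
Proof. exact/multilinearZ/multilinear_perm_sum. Qed.

Lemma multilinear_split_symm k : multilinear (split_symm T k).
Proof. exact/multilinearZ/multilinear_perm_sum. Qed.

Lemma perm_eq_ord (B : eqType) (x0 : B) (w w' : seq B) : size w = n -> perm_eq w w' ->
  exists s : 'S_n, forall l : 'I_n, nth x0 w l = nth x0 w' (s l).
Proof.
move=> wn ww'; have w'n : size w' = n by rewrite -(perm_size ww').
have /tuple_permP[s ws] : perm_eq w (@Tuple n B w' (introT eqP w'n)) by [].
by exists s => l; rewrite {1}ws nth_mktuple (tnth_nth x0).
Qed.

Lemma tens_perm_sum_eq (P : pred 'S_n) (h h' : 'I_n -> H) (s : 'S_n) :
  (forall t, P (t * s)%g = P t) -> h =1 h' \o s ->
  \sum_(t | P t) tens T (h \o t) = \sum_(t | P t) tens T (h' \o t).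
Proof.
move=> Ps hs; rewrite [RHS](reindex_inj (mulIg s)) /=.
apply: eq_big => t; first by rewrite Ps.
by move=> _; congr tens; apply/funext => l; rewrite /= hs /= permM.
Qed.

Lemma ord_fun_map (B : Type) (x0 : B) (f : B -> H) (w : seq B) l : size w = n ->
  ord_fun (map f w) l = f (nth x0 w l) :> H.
Proof. by move=> wn; rewrite /ord_fun (nth_map x0) // wn. Qed.

Lemma symm_perm_eq (B : eqType) (f : B -> H) (w w' : seq B) :
  size w = n -> perm_eq w w' ->
  symm T (ord_fun (map f w)) = symm T (ord_fun (map f w')).
Proof.
move=> wn ww'; case: w => [|x0 w] in wn ww' *.
  by move: ww'; rewrite perm_sym => /perm_nilP ->.
have [s ws] := perm_eq_ord x0 wn ww'.
congr (_ *: _); apply: (tens_perm_sum_eq (s := s)) => // l; rewrite [RHS]/comp.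
rewrite !(ord_fun_map x0) //; last by rewrite -(perm_size ww').
by rewrite ws.
Qed.

(** The tag of a letter records its block, so the permutation matching the two words automatically
    preserves the first k positions. *)
Lemma split_symm_perm_eq (B : eqType) (f : B -> H) (k : nat) (tag : B -> bool)
    (w w' : seq B) : size w = n -> perm_eq w w' ->
  (forall x0 (l : 'I_n), tag (nth x0 w l) = (l < k)%N) ->
  (forall x0 (l : 'I_n), tag (nth x0 w' l) = (l < k)%N) ->
  split_symm T k (ord_fun (map f w)) = split_symm T k (ord_fun (map f w')).
Proof.
move=> wn ww' kw kw'; case: w => [|x0 w] in wn ww' kw *.
  by move: ww'; rewrite perm_sym => /perm_nilP ->.
have [s ws] := perm_eq_ord x0 wn ww'.
congr (_ *: _); apply: (tens_perm_sum_eq (s := s)) => [t|l]; last rewrite [RHS]/comp.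
  apply: eq_forallb => l; rewrite permM.
  by rewrite -(kw x0 (t l)) -(kw' x0 (s (t l))) ws.
rewrite !(ord_fun_map x0) //; last by rewrite -(perm_size ww').
by rewrite ws.
Qed.

Lemma ord_fun_nseq (x : H) : ord_fun (nseq n x) = (fun=> x) :> ('I_n -> H).
Proof. by apply/funext => l; rewrite /ord_fun nth_nseq ltn_ord. Qed.

Lemma symm_diag (x : H) : symm T (fun=> x) = tens T (fun=> x).
Proof.
rewrite /symm (eq_bigr (fun=> tens T (fun=> x))) // sumr_const card_Sn.
by rewrite -[X in _ *: X]scaler_nat scalerA mulVf ?scale1r // pnatr_eq0 -lt0n fact_gt0.
Qed.

(** A diagonal tensor is its own symmetrization, so its expansion can be written with symmetrized
    words, on which the integral is prescribed. *)
Lemma symm_diag_wsum (I : Type) (s : seq (K * I)) (f : I -> H) :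
  tens T (fun=> \sum_(x <- s) x.1 *: f x.2) =
  wsum s n (fun w => symm T (ord_fun (map f w))).
Proof.
rewrite -symm_diag -ord_fun_nseq.
have := @multilinear_wsum _ (symm T) I [::] [::] s f n multilinear_symm (leqnn _).
rewrite cats0 /= => ->; by apply: eq_wsum => w _; rewrite cats0.
Qed.
End Multilinear.

Section Polarization.
Variables (K : numFieldType) (theta : K -> K) (H : hilbert theta) (n : nat).
Variable T : tensor_power H n.

(** With the weights moved into the summand, the expansions for all subsets in [symm_polarization]
    run over one alphabet. *)
Lemma wsum_weights (V : lmodType K) (I : Type) (c : I -> K) (r : seq I) m
    (F : seq I -> V) :
  wsum [seq (c i, i) | i <- r] m F =
  wsum [seq (1, i) | i <- r] m (fun w => \prod_(i <- w) c i *: F w).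
Proof.
elim: m F => [|m IHm] F /=; first by rewrite big_nil scale1r.
rewrite !big_map; apply: eq_bigr => i _ /=; rewrite IHm scale1r.
rewrite -wsumZ; apply: eq_wsum => w _; by rewrite big_cons scalerA.
Qed.

Lemma wsum_sum (V : lmodType K) (I J : Type) (s : seq (K * I)) m (r : seq J)
    (F : J -> seq I -> V) :
  wsum s m (fun w => \sum_(j <- r) F j w) = \sum_(j <- r) wsum s m (F j).
Proof.
elim: r => [|j r IHr].
  rewrite big_nil -[RHS](scale0r (wsum s m (fun=> 0))) -wsumZ.
  by apply: eq_wsum => w _; rewrite big_nil scaler0.
by rewrite big_cons -IHr -wsumD; apply: eq_wsum => w _; rewrite big_cons.
Qed.

Lemma wsum_scaler (V : lmodType K) (I : Type) (s : seq (K * I)) m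
    (F : seq I -> K^o) (v : V) :
  wsum s m (fun w => F w *: v) = wsum s m F *: v.
Proof.
elim: m F => [|m IHm] F //=; rewrite scaler_suml.
by apply: eq_bigr => x _; rewrite IHm scalerA.
Qed.

Lemma wsum_ge0 (I : Type) (r : seq I) m (F : seq I -> K^o) :
  (forall w, 0 <= F w) -> 0 <= wsum [seq (1, i) | i <- r] m F.
Proof.
elim: m F => [|m IHm] F F0; first exact: F0.
by rewrite /= big_map sumr_ge0 // => i _; rewrite scale1r; apply: IHm.
Qed.

(** Applied to the word listing each letter once, it shows that the normalizing count in
    [symm_polarization] is nonzero without computing it. *)
Lemma wsum_ge (I : eqType) (r : seq I) m (F : seq I -> K^o) (w0 : seq I) :
  (forall w, 0 <= F w) -> size w0 = m -> {subset w0 <= r} -> uniq r ->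
  F w0 <= wsum [seq (1, i) | i <- r] m F.
Proof.
move=> F0 wm wr ur; elim: w0 m F F0 wm wr => [|i w IHw] [|m] F F0 //= [wm] wr.
rewrite big_map (bigD1_seq i) ?wr ?mem_head //= scale1r.
rewrite (@le_trans _ _ (wsum [seq (1, i) | i <- r] m (fun w => F (i :: w)))) //.
  apply: (IHw m (fun w => F (i :: w))) => // j jw; apply: wr.
  by rewrite inE jw orbT.
rewrite lerDl sumr_ge0 // => j _; rewrite scale1r.
exact: wsum_ge0.
Qed.

(* inclusion-exclusion: among the words of length n over 'I_n, those using all
   letters are selected by the signed sum over the subsets b *)
Lemma signed_subsets (w : seq 'I_n) :
  \sum_(b : {ffun 'I_n -> bool}) (\prod_i (if b i then 1 else -1)) *
    \prod_(i <- w) (b i)%:R = [forall i, i \in w]%:R :> K.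
Proof.
have prod_w (b : {ffun 'I_n -> bool}) : \prod_(i <- w) (b i)%:R =
    \prod_i (if i \in w then (b i)%:R else 1) :> K.
  have -> : \prod_(i <- w) (b i)%:R = (all b w)%:R :> K.
    elim: w => [|i w IHw]; first by rewrite big_nil.
    by rewrite big_cons IHw /=; case: (b i); rewrite ?mul1r ?mul0r.
  case: allP => [bw|/allP/allPn[i iw bi]].
    by rewrite big1 // => i _; case: ifP => // /bw ->.
  by rewrite (bigD1 i) //= iw (negPf bi) mul0r.
under eq_bigr => b _.
  rewrite prod_w -big_split /=; over.
rewrite -(bigA_distr_bigA (fun (i : 'I_n) (c : bool) =>
  (if c then 1 else -1) * (if i \in w then c%:R else 1) : K)).
case: forallP => [wT|/forallP/forallPn[i iw]].
  by rewrite big1 // => i _; rewrite big_bool wT /= mulr1 mulr0 addr0.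
rewrite (bigD1 i) //= big_bool (negPf iw) !mulr1 /=.
by rewrite subrr mul0r.
Qed.

(** In the signed sum of the n-th powers of the partial sums [g b], [signed_subsets] kills every
    word that misses a letter. The other words are rearrangements of h_0, ..., h_(n-1), each
    contributing [symm T h]; [N] counts them. *)
Lemma symm_polarization (h : 'I_n -> H) :
  lin_span (range (fun x : H => tens T (fun=> x))) (symm T h).
Proof.
pose r := enum 'I_n; pose one := [seq (1 : K, i) | i <- r].
pose F w := symm T (ord_fun (map h w)).
pose N : K := wsum one n (fun w => [forall i, i \in w]%:R : K^o).
have N0 : N != 0.
  rewrite gt_eqF // (lt_le_trans ltr01) //.
  have := @wsum_ge _ r n (fun w => [forall i, i \in w]%:R) r.
  have -> : [forall i, i \in r] by apply/forallP => i; rewrite mem_enum.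
  by apply => //; [exact: size_enum_ord|exact: enum_uniq].
have FE w : size w = n -> [forall i, i \in w] -> F w = symm T h.
  move=> wn /forallP wT; rewrite /F (@symm_perm_eq _ _ _ _ _ _ _ _ (enum 'I_n)) //.
    by congr symm; apply/funext => i; rewrite (ord_fun_map i) ?size_enum_ord // nth_ord_enum.
  rewrite perm_sym; apply: uniq_perm; rewrite ?enum_uniq //.
    by rewrite (@leq_size_uniq _ (enum 'I_n)) ?enum_uniq // ?size_enum_ord ?wn // => i _.
  by move=> i; rewrite mem_enum wT.
pose sgn (b : {ffun 'I_n -> bool}) : K := \prod_i (if b i then 1 else -1).
pose g (b : {ffun 'I_n -> bool}) : H := \sum_i (b i)%:R *: h i.
exists [seq (sgn b / N, tens T (fun=> g b)) | b <- index_enum {ffun 'I_n -> bool}].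
  by move=> _ /mapP[b _ ->]; exists (g b).
rewrite big_map /=.
have gE b : tens T (fun=> g b) = wsum one n (fun w => \prod_(i <- w) (b i)%:R *: F w).
  rewrite -wsum_weights -symm_diag_wsum /g; congr tens; apply/funext => _.
  by rewrite big_map /r big_enum.
apply: (scalerI N0); rewrite scaler_sumr.
under eq_bigr => b _.
  rewrite scalerA mulrC divfK // gE -wsumZ; over.
rewrite -wsum_sum.
rewrite -wsum_scaler; apply: eq_wsum => w wn.
under [RHS]eq_bigr do rewrite scalerA.
rewrite -scaler_suml signed_subsets.
by case: (boolP [forall i, i \in w]) => [wT|_]; rewrite ?scale0r // FE.
Qed.
End Polarization.

(** Such a permutation is uniquely a product of one supported on the first k positions and one
    supported on the rest. *)
Lemma card_perm_preserving n k : (k <= n)%N ->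
  #|[pred s : 'S_n | [forall l, (s l < k)%N == (l < k)%N]]| = (k`! * (n - k)`!)%N.
Proof.
move=> kn; pose A : {set 'I_n} := [set l : 'I_n | (l < k)%N]%SET.
have cA : #|A| = k.
  rewrite -sum1_card (eq_bigl (fun l : 'I_n => (l < k)%N)); last by move=> l; rewrite inE.
  by rewrite -(big_ord_widen n (fun=> 1%N)) // sum1_card card_ord.
have cAc : #|~: A| = (n - k)%N by rewrite cardsCs finset.setCK card_ord cA.
transitivity (#|perm_on A| * #|perm_on (~: A)|)%N; last by rewrite !card_perm cA cAc.
rewrite -cardsE.
pose D := finset.setX [set s | perm_on A s]%SET [set s | perm_on (~: A) s]%SET.
have mulE (x y : 'S_n) l : perm_on A x -> perm_on (~: A) y ->
    (x * y)%g l = if l \in A then x l else y l.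
  move=> Ax Ay; rewrite permM; case: ifP => lA.
    by rewrite (out_perm Ay) // finset.in_setC (perm_closed _ Ax) lA.
  by rewrite (out_perm Ax) ?lA.
transitivity #|D|; last by rewrite cardsX !cardsE.
rewrite -(@card_in_imset _ _ (fun xy : 'S_n * 'S_n => (xy.1 * xy.2)%g) D); last first.
  move=> [x y] [x' y']; rewrite !inE /= => /andP[Ax Ay] /andP[Ax' Ay'] xy.
  congr pair; apply/permP => l; have /permP/(_ l) := xy; rewrite !mulE //.
    by case: ifP => // /negbT lA _; rewrite (out_perm Ax lA) (out_perm Ax' lA).
  by case: ifP => // lA _; rewrite (out_perm Ay) ?(out_perm Ay') // finset.in_setC lA.
apply: eq_card => s; rewrite inE; apply/forallP/imsetP => /= [sA|[[x y]] /=].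
  have sN : s \in 'N(A | 'P)%g.
    by apply/astabsP => l; rewrite /= /aperm !inE (eqP (sA l)).
  have sN' : s \in 'N(~: A | 'P)%g.
    by apply/astabsP => l; rewrite /= /aperm !inE (eqP (sA l)).
  exists (restr_perm A s, restr_perm (~: A) s).
    by rewrite !inE /= !restr_perm_on.
  apply/permP => l /=; rewrite mulE ?restr_perm_on //.
  by case: ifP => lA; rewrite restr_permE // inE lA.
rewrite !inE /= => /andP[Ax Ay] -> l; apply/eqP.
have := mulE x y l Ax Ay; case: ifP => lA ->.
  by have := perm_closed l Ax; rewrite !inE.
by have := perm_closed l Ay; rewrite !inE => /negb_inj.
Qed.

Section BlockTensors.
Variables (K : numFieldType) (theta : K -> K) (H : hilbert theta) (n : nat).
Variables (T : tensor_power H n) (k : nat).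
Hypothesis kn : (k <= n)%N.

Definition block_tensor (x y : H) : T := tens T (fun l => if (l < k)%N then x else y).

Lemma ord_fun_block (x y : H) : ord_fun (nseq k x ++ nseq (n - k) y) =
  (fun l => if (l < k)%N then x else y) :> ('I_n -> H).
Proof.
apply/funext => l; rewrite /ord_fun nth_cat size_nseq !nth_nseq.
by case: ltnP => // kl; rewrite ltn_sub2r // (leq_ltn_trans kl).
Qed.

Lemma split_symm_block (x y : H) :
  split_symm T k (ord_fun (nseq k x ++ nseq (n - k) y)) = block_tensor x y.
Proof.
rewrite /split_symm (eq_bigr (fun=> block_tensor x y)); last first.
  move=> s /forallP sk; rewrite ord_fun_block; congr tens; apply/funext => l /=.
  by rewrite (eqP (sk l)).
rewrite sumr_const card_perm_preserving // -[X in _ *: X]scaler_nat scalerA.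
by rewrite mulVf ?scale1r // pnatr_eq0 -lt0n muln_gt0 !fact_gt0.
Qed.

Lemma block_tensor_wsum (I J : Type) (s : seq (K * I)) (t : seq (K * J))
    (f : I -> H) (g : J -> H) :
  block_tensor (\sum_(x <- s) x.1 *: f x.2) (\sum_(y <- t) y.1 *: g y.2) =
  wsum s k (fun v => wsum t (n - k) (fun u =>
    split_symm T k (ord_fun (map f v ++ map g u)))).
Proof.
rewrite -split_symm_block.
have ML := @multilinear_split_symm _ _ _ _ T k.
have /= -> := multilinear_wsum (r := [::])
  (nseq (n - k) (\sum_(y <- t) y.1 *: g y.2)) s f ML kn.
apply: eq_wsum => v vk.
have := multilinear_wsum (r := map f v) [::] t g (m := n - k) ML.
rewrite size_map vk subnKC // cats0 => /(_ (leqnn _)) ->.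
by apply: eq_wsum => u _; rewrite cats0.
Qed.

Lemma split_sym_power_block (x y : H) : split_sym_power T k (block_tensor x y).
Proof. by apply: sub_closed_span; rewrite -split_symm_block; eexists. Qed.
End BlockTensors.

(** * Columns of components as complex tensors *)

Section Twist.
Variables (R : realType) (H : real_hilbert R).
Local Notation C := R[i].

(* W(h) = sqrt 2 Re Z(twist h) *)
Definition twist (h : dsum H H) : cplx H := cpair h.1 (- h.2).

Lemma twistB h h' : twist (h - h') = twist h - twist h'.
Proof. by congr pair; rewrite /= opprD. Qed.

Lemma sqnorm_twist h : sqnorm (hdot (cplx H)) (twist h) = (sqnorm (hdot (dsum H H)) h)%:C%C.
Proof.
rewrite [LHS]sqnorm_cplx; congr (_%:C)%C.
by rewrite /sqnorm [LHS]/(dsum_fun _ _) /dsum_fun /= linearNl linearNr opprK.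
Qed.

Lemma cconj_sum (I : Type) (s : seq (C * I)) (f : I -> cplx H) :
  cconj (\sum_(x <- s) x.1 *: f x.2) = \sum_(x <- s) conjc x.1 *: cconj (f x.2) :> cplx H.
Proof.
elim: s => [|x s IHs]; first by rewrite !big_nil; congr pair; rewrite /= oppr0.
rewrite !big_cons -IHs; case: x => -[a b] i /=.
congr pair => /=; first by rewrite scalerN scaleNr !opprK.
by rewrite scalerN scaleNr !opprD.
Qed.

Variables (n : nat) (T : tensor_power H n).

(** The square norm of the difference is computed from [tens_dot], which treats all slots at once
    instead of one by one. *)
Lemma tensZ (c : 'I_n -> R) (h : 'I_n -> H) :
  tens T (fun l => c l *: h l) = (\prod_l c l) *: tens T h.
Proof.
apply/eqP; rewrite -subr_eq0; apply/eqP/(sqnorm_eq0 (dot := hdot T)).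
have D a b : '<tens T (fun l => a l *: h l), tens T (fun l => b l *: h l)> =
    (\prod_l a l) * (\prod_l b l) * '<tens T h, tens T h>.
  rewrite !tens_dot -!big_split; apply: eq_bigr => l _ /=.
  by rewrite linearZl_LR linearZr_LR /= mulrA.
have h1 : tens T h = tens T (fun l => 1 *: h l).
  by congr tens; apply/funext => l; rewrite scale1r.
have Dl : '<tens T (fun l => c l *: h l), tens T h> = (\prod_l c l) * '<tens T h, tens T h>.
  by rewrite {1}h1 D big1_eq mulr1.
have Dr : '<tens T h, tens T (fun l => c l *: h l)> = (\prod_l c l) * '<tens T h, tens T h>.
  by rewrite {1}h1 D big1_eq mul1r.
rewrite /sqnorm linearBl !linearBr !linearZl_LR !linearZr_LR /= D Dl Dr /GRing.scale /=.
by ring.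
Qed.

Lemma cpair0Z (a : R) (V : lmodType R) (x : V) :
  cpair (a *: x) 0 = a%:C%C *: cpair x 0 :> cplx_of V.
Proof. by congr pair; rewrite /= ?scale0r ?subr0 // scaler0 add0r. Qed.

Lemma VcoefE k (j : 'I_(2 ^ n)) : Vcoef R k j =
  \prod_(l < n) (if bit j l then (if (l < k)%N then - 'i%C else 'i%C) else 1).
Proof.
rewrite /Vcoef /bcount /ccount !expr_sum [RHS](bigID (fun l : 'I_n => (l < k)%N)) /=.
congr (_ * _).
  by apply: eq_bigr => l ->; case: bit; rewrite ?expr1 ?expr0.
apply: eq_big => l; first by rewrite leqNgt.
by rewrite leqNgt => /negPf ->; case: bit; rewrite ?expr1 ?expr0.
Qed.

(** With h_l = (f_l, g_l), slot l of the right side is f_l - i g_l for l < k and f_l + i g_l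
    otherwise. Multiplying out, the bits of j choose f_l or g_l in each slot, and the factors
    collected are [Vcoef R k j]. *)
Lemma Vsum_tens k (h : 'I_n -> dsum H H) :
  Vsum (tens (dsum_power T) h) 0 k =
  tens (cplx_power T) (fun l => if (l < k)%N then twist (h l) else cconj (twist (h l))).
Proof.
rewrite /Vsum [RHS]/(cplx_tens _ _) /cplx_tens.
pose B (j : 'I_(2 ^ n)) := [ffun l : 'I_n => bit j l].
have Binj : injective B.
  move=> j j' /ffunP BB; apply/val_inj/(bit_inj (ltn_ord _) (ltn_ord _)) => l ln.
  by have := BB (Ordinal ln); rewrite !ffunE.
have Bbij : bijective B.
  by apply: inj_card_bij => //; rewrite card_ffun card_bool !card_ord.
rewrite [RHS](reindex B) /=; last exact: onW_bij.
apply: eq_bigr => j _.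
(* The sign comes from the imaginary part [- (h l).2] of [twist (h l)] in the first k slots. *)
pose eps (l : 'I_n) : R := if bit j l && (l < k)%N then -1 else 1.
rewrite VcoefE.
rewrite [X in _ = _ *: cpair X _](_ : _ = (\prod_l eps l) *:
   tens T (fun l => if bit j l then (h l).2 else (h l).1)); last first.
  rewrite -tensZ; congr tens; apply/funext => l; rewrite ffunE /eps.
  by case: bit; case: ltnP => _; rewrite /= ?scale1r // ?opprK // scaleN1r.
rewrite cpair0Z scalerA !ffunE rmorph_prod -big_split /=; congr (_ *: _).
apply: eq_bigr => l _; rewrite ffunE /eps; case: bit; case: ltnP => _ /=.
all: by rewrite ?rmorphN ?rmorph1 ?mulr1 ?mulrN1.
Qed.

Lemma Vsum_diag k (h : dsum H H) :
  Vsum (tens (dsum_power T) (fun=> h)) 0 k =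
  block_tensor (cplx_power T) k (twist h) (cconj (twist h)).
Proof. exact: Vsum_tens. Qed.

Lemma Vsum0D k g g' : Vsum (T := T) (g + g') 0 k = Vsum g 0 k + Vsum g' 0 k.
Proof.
rewrite /Vsum -big_split; apply: eq_bigr => j _ /=; rewrite -scalerDr !ffunE.
by congr (_ *: _); congr pair; rewrite /= addr0.
Qed.

Lemma Vsum0Z k (a : R) g : Vsum (T := T) (a *: g) 0 k = a%:C%C *: Vsum g 0 k.
Proof.
rewrite /Vsum scaler_sumr; apply: eq_bigr => j _ /=; rewrite scalerA mulrC -[RHS]scalerA.
by congr (_ *: _); rewrite !ffunE; exact: cpair0Z.
Qed.

Lemma Vsum_split k g1 g2 : Vsum (T := T) g1 g2 k = 'i%C *: Vsum g2 0 k + Vsum g1 0 k.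
Proof.
rewrite /Vsum scaler_sumr -big_split; apply: eq_bigr => j _ /=.
rewrite scalerA mulrC -[in RHS]scalerA -scalerDr !ffunE; congr (_ *: _).
by congr pair; rewrite /= ?scale0r ?scale1r ?scaler0 ?oppr0 ?addr0 ?add0r ?subr0.
Qed.

Lemma Vcoef_norm k (j : 'I_(2 ^ n)) : Vcoef R k j * conjc (Vcoef R k j) = 1.
Proof.
rewrite VcoefE rmorph_prod -big_split big1 // => l _ /=.
by case: bit; [case: ltnP => _|]; apply/eqP; rewrite eq_complex /=; apply/andP;
  split; apply/eqP; ring.
Qed.

Lemma sqnorm_Vsum_le k g : sqnorm (hdot (cplx_power T)) (Vsum g 0 k) <=
  (2 ^+ (2 ^ n) * sqnorm (hdot (dsum_power T)) g)%:C%C.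
Proof.
have := @sqnorm_sum_le _ _ _ (hdot (cplx_power T)) _ (index_enum 'I_(2 ^ n))
  (fun j => Vcoef R k j *: (cpair (g j) 0 : cplx_power T)).
rewrite -[size _]/(size (index_enum 'I_(2 ^ n))).
have -> : size (index_enum 'I_(2 ^ n)) = (2 ^ n)%N by rewrite -sum1_size sum1_card card_ord.
rewrite rmorphM rmorphXn rmorph_nat.
have -> : \sum_j sqnorm (hdot (cplx_power T)) (Vcoef R k j *: (cpair (g j) 0 : cplx_power T)) =
   (sqnorm (hdot (dsum_power T)) g)%:C%C.
  rewrite [sqnorm (hdot (dsum_power T)) g]sqnorm_col rmorph_sum; apply: eq_bigr => j _.
  rewrite sqnormZ Vcoef_norm mul1r [LHS]sqnorm_cplx; congr (_%:C)%C.
  by rewrite /sqnorm [LHS]/(dsum_fun _ _) /dsum_fun /= linear0l addr0.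
apply: le_trans; rewrite /Vsum le_eqVlt; apply/orP; left; apply/eqP.
by congr sqnorm; apply: eq_bigr => j _; rewrite ffunE.
Qed.
End Twist.

(** * Almost sure linearity and continuity *)

Section FastConvergence.
Context {R : realType} {d : measure_display} {Omega : measurableType d}.
Variable P : probability Omega R.

(** The expectations are summable, so the sum of the [f n] is integrable, hence almost surely
    finite, and its terms tend to 0. *)
Lemma ae_cvg0_fast (f : nat -> Omega -> R) (c : R) :
  (forall n, measurable_fun [set: Omega] (f n)) -> (forall n w, 0 <= f n w) ->
  (forall n, ('E_P[f n] <= (c / 2 ^+ n)%:E)%E) ->
  {ae P, forall w, f n w @[n --> \oo] --> (0 : R)}.
Proof.
move=> mf f0 fc; pose F (n : nat) (w : Omega) : \bar R := (f n w)%:E.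
have mF n : measurable_fun [set: Omega] (F n) by apply/measurable_EFinP.
have F0 n w : (0 <= F n w)%E by rewrite lee_fin.
have SF : P.-integrable [set: Omega] (fun w => \sum_(n <oo) F n w)%E.
  apply/integrableP; split.
    by apply: ge0_emeasurable_sum => // n w _ _.
  rewrite (eq_integral (fun w => \sum_(n <oo) F n w)%E); last first.
    by move=> w _; rewrite gee0_abs // nneseries_ge0.
  rewrite integral_nneseries //.
  apply: (@le_lt_trans _ _ (\sum_(n <oo) (2 * c / (2 ^ (n + 1))%:R)%:E)%E).
    apply: lee_nneseries => n _; first by rewrite integral_ge0.
    have := fc n; rewrite unlock => /le_trans; apply.
    rewrite lee_fin natrX exprD expr1 le_eqVlt; apply/orP; left; apply/eqP.
    by field; rewrite expf_neq0 // pnatr_eq0.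
  have /(cvg_lim (@ereal_hausdorff R)) := @cvg_geometric_eseries_half R (2 * c) 0.
  by rewrite /eseries => ->; rewrite ltry.
have := integrable_ae measurableT SF; apply: filterS => w /(_ I) Fw.
apply: cvg_series_cvg_0.
apply: nondecreasing_is_cvgn.
  apply: nondecreasing_series => n _ _; exact: f0.
exists (fine (\sum_(n <oo) F n w)%E) => _ [n _ <-].
rewrite -lee_fin fineK // /series /= -sumEFin.
by apply: (@nneseries_lim_ge _ (F ^~ w)) => k _ _; exact: F0.
Qed.

(** The second family is there because the complex isometry controls real and imaginary parts only
    through the sum of their squares. *)
Lemma ae_cvg0_sqr_fast (f g : nat -> Omega -> R) (c : R) :
  (forall n, measurable_fun [set: Omega] (f n)) ->
  (forall n, measurable_fun [set: Omega] (g n)) ->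
  (forall n, ('E_P[fun w => (f n w ^+ 2 + g n w ^+ 2)%R] <= (c / 2 ^+ n)%:E)%E) ->
  {ae P, forall w, f n w @[n --> \oo] --> (0 : R)}.
Proof.
move=> mf mg fc; apply: filterS (ae_cvg0_fast _ _ fc) => [w fg0|n|n w].
- apply/cvgr0Pnorm_lt => e e0.
  have /cvgr0Pnorm_lt /(_ (e ^+ 2)) := fg0; rewrite exprn_gt0 // => /(_ isT).
  apply: filterS => n; rewrite ger0_norm ?addr_ge0 ?sqr_ge0 // => fge.
  rewrite -(@ltr_pXn2r _ 2) ?nnegrE ?(ltW e0) // real_normK ?num_real //.
  by rewrite (le_lt_trans _ fge) // lerDl sqr_ge0.
- by apply: measurable_funD; apply: measurable_funX.
- by rewrite addr_ge0 ?sqr_ge0.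
Qed.

Definition ae_linear (K : pzRingType) (V : lmodType K) (D : set V) (L : V -> Omega -> K) :=
  forall a g g', D g -> D g' ->
    {ae P, forall w, L (a *: g + g') w = a * L g w + L g' w}.

Definition subspace (K : pzRingType) (V : lmodType K) (D : set V) :=
  D 0 /\ forall a g g', D g -> D g' -> D (a *: g + g').

(* continuity along the sequences that converge geometrically fast, which is
   what an L^2 bound provides without passing to subsequences *)
Definition ae_continuous (V : real_hilbert R) (D : set V) (L : V -> Omega -> R) :=
  forall (u : nat -> V) v (c : R), (forall n, D (u n)) -> D v ->
    (forall n, sqnorm (hdot V) (u n - v) <= c / 2 ^+ n) ->
    {ae P, forall w, L (u n) w @[n --> \oo] --> L v w}.

Lemma subspaceT (K : pzRingType) (V : lmodType K) : subspace [set: V].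
Proof. by split. Qed.

Section AlmostSureLinearity.
Variables (K : pzRingType) (V : lmodType K) (D : set V) (L : V -> Omega -> K).
Hypotheses (D_sub : subspace D) (L_lin : ae_linear D L).

Lemma subspaceB g g' : D g -> D g' -> D (g - g').
Proof. by move=> Dg Dg'; rewrite addrC -scaleN1r; apply: D_sub.2. Qed.

Lemma ae_linear0 : {ae P, forall w, L 0 w = 0}.
Proof.
have := L_lin 1 D_sub.1 D_sub.1; apply: filterS => w.
rewrite scaler0 addr0 mul1r => L0; apply: (addrI (L 0 w)).
by rewrite addr0 -L0.
Qed.

Lemma ae_linearZ a g : D g -> {ae P, forall w, L (a *: g) w = a * L g w}.
Proof.
move=> Dg; apply: filterS2 (L_lin a Dg D_sub.1) ae_linear0 => w.
by rewrite addr0 => -> ->; rewrite addr0.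
Qed.

Lemma ae_linearB g g' : D g -> D g' ->
  {ae P, forall w, L (g - g') w = L g w - L g' w}.
Proof.
move=> Dg Dg'; have := L_lin (-1) Dg' Dg; apply: filterS => w.
by rewrite scaleN1r addrC mulN1r [RHS]addrC.
Qed.

Lemma subspace_sum (I : Type) (s : seq (K * I)) (G : I -> V) :
  (forall x, D (G x)) -> D (\sum_(x <- s) x.1 *: G x.2).
Proof.
move=> DG; elim: s => [|x s IHs]; first by rewrite big_nil; exact: D_sub.1.
by rewrite big_cons; apply: D_sub.2.
Qed.

Lemma ae_linear_sum (I : Type) (s : seq (K * I)) (G : I -> V) :
  (forall x, D (G x)) ->
  {ae P, forall w, L (\sum_(x <- s) x.1 *: G x.2) w = \sum_(x <- s) x.1 * L (G x.2) w}.
Proof.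
move=> DG; elim: s => [|x s IHs].
  by apply: filterS ae_linear0 => w L0; rewrite !big_nil.
have := L_lin x.1 (DG x.2) (subspace_sum s DG); move: IHs.
by apply: filterS2 => w Ls; rewrite !big_cons Ls.
Qed.
End AlmostSureLinearity.

Lemma subspace_wsum (K : comNzRingType) (V : lmodType K) (D : set V) (I : Type)
    (s : seq (K * I)) m (F : seq I -> V) : subspace D ->
  (forall v, D (F v)) -> D (wsum s m F).
Proof.
move=> DS; elim: m F => [|m IHm] F DF //=.
by apply: (subspace_sum DS s (G := fun i => wsum s m (fun v => F (i :: v)))) => i; exact: IHm.
Qed.

Lemma ae_linear_wsum (K : comNzRingType) (V : lmodType K) (D : set V)
    (L : V -> Omega -> K) (I : Type) (s : seq (K * I)) m (F : seq I -> V)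
    (b : seq I -> Omega -> K) :
  subspace D -> ae_linear D L -> (forall v, D (F v)) ->
  (forall v, size v = m -> {ae P, forall w, L (F v) w = b v w}) ->
  {ae P, forall w, L (wsum s m F) w = wsum s m (fun v => b v w : K^o)}.
Proof.
move=> DS LL; elim: m F b => [|m IHm] F b DF Lb; first exact: Lb.
have := ae_linear_sum DS LL s (G := fun i => wsum s m (fun v => F (i :: v)))
  (fun i => subspace_wsum s m DS (fun v => DF (i :: v))).
have H t : {ae P, forall w, \sum_(x <- t) x.1 * L (wsum s m (fun v => F (x.2 :: v))) w =
    \sum_(x <- t) x.1 *: (wsum s m (fun v => b (x.2 :: v) w : K^o) : K^o)}.
  elim: t => [|x t IHt]; first by apply: aeW => w; rewrite !big_nil.
  have := IHm (fun v => F (x.2 :: v)) (fun v => b (x.2 :: v)) (fun v => DF _).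
  have Lb' v : size v = m -> {ae P, forall w, L (F (x.2 :: v)) w = b (x.2 :: v) w}.
    by move=> vm; apply: Lb; rewrite /= vm.
  move=> /(_ Lb'); move: IHt; apply: filterS2 => w tE xE.
  by rewrite !big_cons tE xE.
by move: (H s); apply: filterS2 => w sE LE; rewrite /= LE sE.
Qed.

Section L2Bounded.
Variables (V : real_hilbert R) (D : set V) (L : V -> Omega -> R).
Hypotheses (D_sub : subspace D) (L_lin : ae_linear D L).

Lemma ae_continuous_L2 (M : V -> Omega -> R) (c0 : R) :
  (forall g, D g -> measurable_fun [set: Omega] (L g)) ->
  (forall g, D g -> measurable_fun [set: Omega] (M g)) ->
  (forall g, D g -> ('E_P[fun w => (L g w ^+ 2 + M g w ^+ 2)%R] <=
     (c0 * sqnorm (hdot V) g)%:E)%E) ->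
  0 <= c0 -> ae_continuous D L.
Proof.
move=> mL mM EL c00 u v c Du Dv uv.
have Duv n : D (u n - v) by apply: subspaceB.
have ae_uv : {ae P, forall w, forall n, L (u n - v) w = L (u n) w - L v w}.
  by apply: ae_foralln => n; exact: (ae_linearB L_lin (Du n) Dv).
have := ae_cvg0_sqr_fast (f := fun n => L (u n - v)) (g := fun n => M (u n - v))
  (c := c0 * c) (fun n => mL _ (Duv n)) (fun n => mM _ (Duv n)).
have bound n : ('E_P[fun w => (L (u n - v) w ^+ 2 + M (u n - v) w ^+ 2)%R] <=
    (c0 * c / 2 ^+ n)%:E)%E.
  by rewrite (le_trans (EL _ (Duv n))) // lee_fin -mulrA ler_wpM2l.
move=> /(_ bound); move: ae_uv; apply: filterS2 => w wE w0.
rewrite -[L v w]add0r -(_ : (fun n => L (u n - v) w + L v w) = fun n => L (u n) w).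
  by apply: cvgD => //; exact: cvg_cst.
by apply/funext => n; rewrite wE subrK.
Qed.
End L2Bounded.

Lemma ae_linearD (V : lmodType R) (D : set V) (L L' : V -> Omega -> R) (c : R) :
  ae_linear D L -> ae_linear D L' ->
  ae_linear D (fun g w => L g w + c * L' g w).
Proof.
move=> lL lL' a g g' Dg Dg'; apply: filterS2 (lL a g g' Dg Dg') (lL' a g g' Dg Dg').
by move=> w -> ->; ring.
Qed.

Lemma ae_continuousD (V : real_hilbert R) (D : set V) (L L' : V -> Omega -> R) (c : R) :
  ae_continuous D L -> ae_continuous D L' ->
  ae_continuous D (fun g w => L g w + c * L' g w).
Proof.
move=> lL lL' u v e Du Dv uv; apply: filterS2 (lL _ _ _ Du Dv uv) (lL' _ _ _ Du Dv uv).
by move=> w L1 L2; apply: cvgD => //; apply: cvgMr.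
Qed.

Lemma ae_linear_bigsum (V : lmodType R) (D : set V) (I : Type) (r : seq I)
    (L : I -> V -> Omega -> R) : (forall i, ae_linear D (L i)) ->
  ae_linear D (fun g w => \sum_(i <- r) L i g w).
Proof.
move=> lL a g g' Dg Dg'; elim: r => [|i r IHr].
  by apply: aeW => w; rewrite !big_nil mulr0 addr0.
apply: filterS2 (lL i a g g' Dg Dg') IHr.
by move=> w iE rE; rewrite !big_cons iE rE; ring.
Qed.

Lemma ae_continuous_bigsum (V : real_hilbert R) (D : set V) (I : Type) (r : seq I)
    (L : I -> V -> Omega -> R) : (forall i, ae_continuous D (L i)) ->
  ae_continuous D (fun g w => \sum_(i <- r) L i g w).
Proof.
move=> lL u v c Du Dv uv; elim: r => [|i r IHr].
  apply: aeW => w; rewrite big_nil (_ : (fun n => _) = cst 0); first exact: cvg_cst.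
  by apply/funext => n; rewrite big_nil.
apply: filterS2 (lL i u v c Du Dv uv) IHr => w iE rE; rewrite big_cons.
rewrite (_ : (fun n => _) = fun n => L i (u n) w + \sum_(i <- r) L i (u n) w).
  exact: cvgD.
by apply/funext => n; rewrite big_cons.
Qed.

Section Isonormal.
Variables (H : real_hilbert R) (X : H -> {RV P >-> R}).
Hypothesis X_iso : isonormal X.

Lemma isonormal_Lfun2 h : (X h : Omega -> R) \in Lfun P 2%:E.
Proof.
rewrite inE; apply/andP; split; rewrite inE //= /finite_norm unlock /Lnorm.
apply: poweR_lty; rewrite (_ : (\int[P]_w _)%E = 'E_P[fun w => (X h w * X h w)%R])%E.
  by rewrite (isonormal_cov X_iso) ltry.
rewrite unlock; apply: eq_integral => w _ /=.
by rewrite powR_mulrn // real_normK ?num_real.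
Qed.

(** The defect X(ag + h) - aX(g) - X(h) has second moment 0, by expanding its square into nine
    covariances. *)
Lemma isonormal_linear : ae_linear [set: H] X.
Proof.
move=> a g h _ _; pose f w : R := X (a *: g + h) w - (a * X g w + X h w).
have mf : measurable_fun [set: Omega] f.
  apply: measurable_funB => //; apply: measurable_funD => //.
  by apply: measurable_funM => //; exact: measurable_cst.
suff Ef : ('E_P[fun w => (f w ^+ 2 + cst 0 w ^+ 2)%R] = 0)%E.
  have bound (n : nat) : ('E_P[fun w => (f w ^+ 2 + cst 0 w ^+ 2)%R] <= (0 / 2 ^+ n)%:E)%E.
    by rewrite Ef mul0r.
  (* A constant sequence with zero second moments converges to 0 almost surely, so [f] vanishes
     almost surely. *)
  have := ae_cvg0_sqr_fast (f := fun=> f) (g := fun=> cst 0) (c := 0)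
    (fun=> mf) (fun=> measurable_cst _) bound.
  apply: filterS => w fw.
  apply/eqP; rewrite -subr_eq0; apply/eqP.
  by apply: (cvg_unique _ _ fw) => //; exact: cvg_cst.
pose c (i : 'I_3) : R := tnth [tuple 1; - a; -1] i.
pose x (i : 'I_3) : H := tnth [tuple (a *: g + h); g; h] i.
have fE w : f w ^+ 2 + cst 0 w ^+ 2 = \sum_i \sum_j (c i * c j) * (X (x i) w * X (x j) w).
  by rewrite /f !big_ord_recl !big_ord0 /c /x !(tnth_nth 0) /=; ring.
have prod_Lfun1 i j : (X (x i) \* X (x j) : Omega -> R) \in Lfun P 1.
  by apply: Lfun2_mul_Lfun1; exact: isonormal_Lfun2.
rewrite (_ : (fun w => _) = \sum_(F <- [seq (c ij.1 * c ij.2) \o* (X (x ij.1) \* X (x ij.2))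
   | ij <- index_enum ('I_3 * 'I_3)%type]) F); last first.
  apply/funext => w; rewrite fE big_map fct_sumE pair_bigA /=.
  by apply: eq_bigr => ij _ /=; rewrite mulrC.
rewrite expectation_sum; last first.
  by move=> _ /mapP[ij _ ->]; apply: Lfun_scale => //; exact: prod_Lfun1.
rewrite big_map (eq_bigr (fun ij => (c ij.1 * c ij.2 * '<x ij.1, x ij.2>)%:E)); last first.
  move=> ij _; rewrite expectationZl; last exact: prod_Lfun1.
  by rewrite [RHS]EFinM -(isonormal_cov X_iso).
rewrite sumEFin -(pair_bigA _ (fun i j => c i * c j * '<x i, x j>)) /=; congr EFin.
rewrite !big_ord_recl !big_ord0 /c /x !(tnth_nth 0) /=.
rewrite !(linearDl, linearDr) !(linearZl_LR, linearZr_LR) /= (hdotC h g).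
by rewrite /GRing.scale /=; ring.
Qed.

Lemma isonormal_continuous : ae_continuous [set: H] X.
Proof.
have D_sub : subspace [set: H] by split.
apply: (ae_continuous_L2 D_sub isonormal_linear (M := fun=> cst 0) (c0 := 1)) => // h _.
rewrite mul1r (_ : (fun w => _) = (fun w => (X h w * X h w)%R)).
  by rewrite (isonormal_cov X_iso).
by apply/funext => w; rewrite /= expr0n addr0.
Qed.
End Isonormal.
End FastConvergence.

(** * Limits of vectors and of their tensor powers *)

Section HilbertLimits.
Variables (R : realType) (G : real_hilbert R).
Implicit Types (x y h : G).
Local Notation sqn := (sqnorm (hdot G)).

(** Cauchy-Schwarz, from the square norm of |y|^2 x - <x, y> y, which avoids division. *)
Lemma hdot_sqr_le x y : '<x, y> ^+ 2 <= sqn x * sqn y.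
Proof.
have [y0|y0] := eqVneq (sqn y) 0.
  by rewrite (sqnorm_eq0 y0) linear0r expr0n mulr_ge0 ?sqnorm_ge0.
have yp : 0 < sqn y by rewrite lt_neqAle eq_sym y0 sqnorm_ge0.
rewrite -subr_ge0 -(pmulr_rge0 _ yp).
have -> : sqn y * (sqn x * sqn y - '<x, y> ^+ 2) = sqn (sqn y *: x - '<x, y> *: y).
  rewrite /sqnorm linearBl !linearBr !linearZl_LR !linearZr_LR /GRing.scale /= (hdotC y x).
  by ring.
exact: sqnorm_ge0.
Qed.

Lemma cvg_hdotl (u : nat -> G) h x : sqn (u n - h) @[n --> \oo] --> (0 : R) ->
  '<u n, x> @[n --> \oo] --> '<h, x>.
Proof.
move=> uh.
suff : '<u n - h, x> @[n --> \oo] --> (0 : R).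
  rewrite (_ : (fun n => '<u n, x>) = (fun n => '<h, x> + '<u n - h, x>)).
    by move=> uh0; rewrite -[X in _ --> X]addr0; apply: cvgD => //; exact: cvg_cst.
  by apply/funext => n; rewrite linearBl addrC subrK.
apply/cvgr0Pnorm_lt => e e0.
have c0 : 0 < sqn x + 1 by rewrite ltr_wpDl // sqnorm_ge0.
have /cvgr0Pnorm_lt /(_ (e ^+ 2 / (sqn x + 1))) := uh.
rewrite divr_gt0 ?exprn_gt0 // => /(_ isT); apply: filterS => n.
rewrite ger0_norm ?sqnorm_ge0 // ltr_pdivlMr // => un.
rewrite -(@ltr_pXn2r _ 2) ?nnegrE ?(ltW e0) // real_normK ?num_real //.
rewrite (le_lt_trans (hdot_sqr_le _ _)) // (le_lt_trans _ un) // ler_wpM2l ?sqnorm_ge0 //.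
by rewrite lerDl.
Qed.

Lemma cvg_sqnorm (u : nat -> G) h : sqn (u n - h) @[n --> \oo] --> (0 : R) ->
  sqn (u n) @[n --> \oo] --> sqn h.
Proof.
move=> uh; have uhh := cvg_hdotl (x := h) uh.
have -> : (fun n => sqn (u n)) =
    (fun n => sqn (u n - h) + ('<u n, h> + '<u n, h> - sqn h)).
  by apply/funext => n; rewrite /sqnorm linearBl !linearBr /= (hdotC h (u n)); ring.
rewrite -[X in _ --> X]add0r -[X in _ --> _ + X](addrK (sqn h)).
by apply: cvgD => //; apply: cvgB; [exact: cvgD|exact: cvg_cst].
Qed.

Lemma cvg0_half (c : R) : c / 2 ^+ n @[n --> \oo] --> (0 : R).
Proof.
have := @cvg_geometric R c 2^-1.
rewrite ger0_norm ?invr_ge0 // invf_lt1 // ltr1n => /(_ isT).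
rewrite (_ : geometric c 2^-1 = (fun n => c / 2 ^+ n)) //.
by apply/funext => n; rewrite /geometric /= exprVn.
Qed.

Lemma cvg0_fast (f : nat -> R) c : (forall n, 0 <= f n) ->
  (forall n, f n <= c / 2 ^+ n) -> f n @[n --> \oo] --> (0 : R).
Proof.
move=> f0 fc; apply: (squeeze_cvgr _ (cvg_cst 0) (cvg0_half c)).
by apply: nearW => n; rewrite f0 fc.
Qed.

(** A sequence tending to h at rate 2^-m has tensor powers that converge, but without a controlled
    rate; a subsequence restores the rate that [ae_continuous] asks for. *)
Lemma diag_dense n (T : tensor_power G n) (S : set G) :
  (forall h e, 0 < e -> exists2 x, S x & sqn (h - x) < e) ->
  forall h, exists u : nat -> G, forall m, [/\ S (u m),
    sqn (u m - h) <= 1 / 2 ^+ m &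
    sqnorm (hdot T) (tens T (fun=> u m) - tens T (fun=> h)) <= 1 / 2 ^+ m].
Proof.
move=> Sd h.
have half_gt0 m : 0 < 1 / 2 ^+ m :> R by rewrite divr_gt0 ?exprn_gt0.
have /choice[v vP] m : exists x, S x /\ sqn (x - h) < 1 / 2 ^+ m.
  have [x Sx hx] := Sd h _ (half_gt0 m); exists x; split => //.
  by rewrite -sqnormN opprB.
have vh : sqn (v m - h) @[m --> \oo] --> (0 : R).
  apply: (cvg0_fast (c := 1)) => m; first exact: sqnorm_ge0.
  by rewrite ltW // (vP m).2.
pose d m : R := sqnorm (hdot T) (tens T (fun=> v m) - tens T (fun=> h)).
have d0 : d m @[m --> \oo] --> (0 : R).
  have dE m : d m = sqn (v m) ^+ n - '<v m, h> ^+ n *+ 2 + sqn h ^+ n.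
    rewrite /d /sqnorm linearBl !linearBr /= (hdotC (tens T (fun=> h)) (tens T (fun=> v m))).
    rewrite !tens_dot !prodr_const card_ord /=; ring.
  under eq_fun do rewrite dE.
  have -> : 0 = sqn h ^+ n - sqn h ^+ n *+ 2 + sqn h ^+ n by ring.
  apply: cvgD; last exact: cvg_cst.
  apply: cvgB.
    by apply: (continuous_cvg _ (@exprn_continuous _ _ _)); exact: cvg_sqnorm.
  apply: cvgMn.
  by apply: (continuous_cvg _ (@exprn_continuous _ _ _)); exact: cvg_hdotl.
(* The condition [m <= j] preserves the bound already known for [v]. *)
have /choice[r rP] m : exists j, (m <= j)%N /\ d j < 1 / 2 ^+ m.
  have /cvgr0Pnorm_lt /(_ _ (half_gt0 m)) [N _ NP] := d0.
  exists (maxn m N); split; first exact: leq_maxl.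
  have := NP (maxn m N) (leq_maxr _ _).
  by rewrite /= ger0_norm // sqnorm_ge0.
exists (fun m => v (r m)) => m; split.
- exact: (vP _).1.
- rewrite (le_trans (ltW (vP _).2)) // !div1r lef_pV2 ?posrE ?exprn_gt0 //.
  by rewrite ler_weXn2l ?ler1n // (rP m).1.
- exact/ltW/(rP m).2.
Qed.

Lemma cvg_scaled_hermite (s x : nat -> R) (s0 x0 : R) n :
  s m @[m --> \oo] --> s0 -> x m @[m --> \oo] --> x0 ->
  scaled_hermite (s m) (x m) n @[m --> \oo] --> scaled_hermite s0 x0 n.
Proof.
move=> ss0 xx0; elim/ltn_ind: n => -[|[|n]] IHn //=; first exact: cvg_cst.
apply: cvgB; first by apply: cvgM => //; exact: (IHn n.+1).
by apply: cvgM; [apply: cvgMr|exact: IHn].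
Qed.
End HilbertLimits.

Section SymmetricPower.
Variables (K : numFieldType) (theta : K -> K) (H : hilbert theta) (n : nat).
Variable T : tensor_power H n.

Lemma subspace_closed_span (S : set T) : subspace (closed_span (hdot T) S).
Proof.
split; first exact: closed_span0.
by move=> a g g' Sg Sg'; apply: closed_spanD => //; exact: closed_spanZ.
Qed.

Lemma lin_span_closed_span (S : set T) : lin_span S `<=` closed_span (hdot T) S.
Proof. by move=> v Sv e e0; exists v => //; rewrite subrr /sqnorm linear0l. Qed.

Lemma sym_power_diag (x : H) : sym_power T (tens T (fun=> x)).
Proof. by apply: sub_closed_span; rewrite -symm_diag; eexists. Qed.

Lemma sym_power_span (g : T) : sym_power T g ->
  closed_span (hdot T) (range (fun x : H => tens T (fun=> x))) g.
Proof.
apply: closed_span_le => _ [h _ <-].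
by apply: lin_span_closed_span; exact: symm_polarization.
Qed.
End SymmetricPower.

Section Diagonal.
Context {R : realType} {d : measure_display} {Omega : measurableType d}.
Variable P : probability Omega R.
Variables (G : real_hilbert R) (n : nat) (T : tensor_power G n).
Variable L : T -> Omega -> R.
Hypothesis L_cont : ae_continuous P (sym_power T) L.

(** The constant [c] lets one statement serve the real parts (c = 1) and the imaginary parts (c =
    0). *)
Lemma diag_extension (W : G -> Omega -> R) (S : set G) (c : R) :
  ae_continuous P [set: G] W ->
  (forall h e, 0 < e -> exists2 x, S x & sqnorm (hdot G) (h - x) < e) ->
  (forall h, S h -> {ae P, forall w, L (tens T (fun=> h)) w =
     c * scaled_hermite (sqnorm (hdot G) h) (W h w) n}) ->
  forall h, {ae P, forall w, L (tens T (fun=> h)) w =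
     c * scaled_hermite (sqnorm (hdot G) h) (W h w) n}.
Proof.
move=> W_cont Sd SL h; have [u uP] := diag_dense T Sd h.
have uh m : sqnorm (hdot G) (u m - h) <= 1 / 2 ^+ m by have [] := uP m.
have Tuh m : sqnorm (hdot T) (tens T (fun=> u m) - tens T (fun=> h)) <= 1 / 2 ^+ m.
  by have [] := uP m.
have uLW : {ae P, forall w, forall m, L (tens T (fun=> u m)) w =
     c * scaled_hermite (sqnorm (hdot G) (u m)) (W (u m) w) n}.
  by apply: ae_foralln => m; apply: SL; have [] := uP m.
have Wu := W_cont u h 1 (fun=> I) I uh.
have Lu := L_cont (fun m => sym_power_diag T (u m)) (sym_power_diag T h) Tuh.
apply: filterS3 uLW Wu Lu => w uLW Wu Lu.
apply: (cvg_unique _ Lu) => //=; under eq_fun do rewrite uLW.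
apply: cvgMr; apply: cvg_scaled_hermite => //; apply: cvg_sqnorm.
by apply: (cvg0_fast _ uh) => m; exact: sqnorm_ge0.
Qed.

Hypothesis L_lin : ae_linear P (sym_power T) L.

(** By polarization a symmetric tensor is a limit, at geometric rate, of finite combinations of
    diagonal ones, where linearity gives 0. *)
Lemma sym_power_vanish : (forall h, {ae P, forall w, L (tens T (fun=> h)) w = 0}) ->
  forall g, sym_power T g -> {ae P, forall w, L g w = 0}.
Proof.
move=> L0 g Sg; have Dsub := subspace_closed_span (range (symm T)).
have lin_span0 v : lin_span (range (fun x : G => tens T (fun=> x))) v ->
    sym_power T v /\ {ae P, forall w, L v w = 0}.
  move=> [s sS ->]; elim: s sS => [|x s IHs] sS.
    by rewrite big_nil; split; [exact: Dsub.1|exact: (ae_linear0 Dsub L_lin)].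
  rewrite big_cons; have [y|Ss s0] := IHs.
    by move=> ys; apply: sS; rewrite inE ys orbT.
  have [h _ hx] := sS x (mem_head _ _).
  have Sx : sym_power T x.2 by rewrite -hx; exact: sym_power_diag.
  split; first exact: Dsub.2.
  have := L_lin x.1 Sx Ss; have := L0 h; rewrite hx; move: s0.
  by apply: filterS3 => w -> -> ->; rewrite mulr0 addr0.
have /choice[u uP] m : exists v, lin_span (range (fun x : G => tens T (fun=> x))) v /\
    sqnorm (hdot T) (v - g) <= 1 / 2 ^+ m.
  have [v Sv vg] := sym_power_span Sg (e := 1 / 2 ^+ m)
    (divr_gt0 ltr01 (exprn_gt0 _ (ltr0n _ 2))).
  by exists v; split => //; rewrite -sqnormN opprB ltW.
have u0 : {ae P, forall w, forall m, L (u m) w = 0}.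
  by apply: ae_foralln => m; exact: (lin_span0 _ (uP m).1).2.
have Lu := L_cont (fun m => (lin_span0 _ (uP m).1).1) Sg (fun m => (uP m).2).
apply: filterS2 u0 Lu => w u0; under eq_fun do rewrite u0.
by move=> Lg; rewrite (cvg_unique _ Lg (cvg_cst 0)).
Qed.
End Diagonal.

(** * Multiple integrals of tensor powers *)

Section WordCounts.
Variable I : countType.

(** The integrals are prescribed on multi-indices while the Wick formulas use words; letter counts
    pass from one to the other. *)
Lemma multi_index_of (v : seq I) :
  exists m : multi_index I, [/\ forall i, m i = count_mem i v, msize m = size v,
    perm_eq (mword m) v & perm_eq (finsupp m) (undup v)].
Proof.
pose m : multi_index I := [fsfun i in [fset i in v]%fset => count_mem i v]%fset.
have mE i : m i = count_mem i v.
  rewrite /m fsfunE !inE /=; case: ifP => // /negbT.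
  by rewrite -has_pred1 has_count -leqNgt leqn0 => /eqP.
have mw : perm_eq (mword m) v.
  rewrite /perm_eq; apply/allP => i _ /=; rewrite -mE /mword count_flatten -map_comp.
  rewrite sumnE big_map.
  rewrite (eq_bigr (fun j => (j == i) * m j)%N); last first.
    by move=> j _; exact: (count_nseq (pred1 i)).
  have [im|im] := boolP (i \in finsupp m).
    rewrite (bigD1_seq i) ?fset_uniq //= eqxx mul1n big1 ?addn0 // => j ji.
    by rewrite (negPf ji).
  rewrite (fsfun_dflt im) big_seq big1 // => j jm.
  by case: eqP jm im => // -> ->.
exists m; split => //.
  rewrite /msize -(perm_size mw) /mword size_flatten /shape -map_comp sumnE big_map.
  by apply: eq_bigr => i _; rewrite /= size_nseq.
apply: uniq_perm; rewrite ?fset_uniq ?undup_uniq // => i.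
by rewrite mem_finsupp mE mem_undup -has_pred1 has_count lt0n.
Qed.
End WordCounts.

Section WienerDiagonal.
Context {R : realType} {d : measure_display} {Omega : measurableType d}.
Variable P : probability Omega R.
Variables (herm : nat -> R -> R) (G : real_hilbert R) (W : G -> Omega -> R).
Hypothesis herm_hermite : is_hermite herm.
Variables (I : countType) (eta : I -> G) (n : nat) (T : tensor_power G n).
Variable Int : T -> Omega -> R.
Hypothesis Int_wiener : is_wiener_integral P herm W eta Int.
Hypothesis eta_on : forall i j, '<eta i, eta j> = (i == j)%:R.
Hypothesis W_lin : ae_linear P [set: G] W.

Lemma wiener_word (v : seq I) : size v = n ->
  {ae P, forall w, Int (symm T (ord_fun (map eta v))) w =
    \prod_(i <- undup v) scaled_hermite 1 (W (eta i) w) (count_mem i v)}.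
Proof.
move=> vn; have [m [mE msz mw mfin]] := multi_index_of v.
have := wiener_basis Int_wiener (etrans msz vn); apply: filterS => w.
rewrite (symm_perm_eq _ _ _ mw) ?(perm_size mw) // => ->.
rewrite (perm_big _ mfin); apply: eq_bigr => i _.
by rewrite mE (herm_scaled_hermite herm_hermite).
Qed.

Lemma wiener_diag_span (h : G) : lin_span (range eta) h ->
  {ae P, forall w, Int (tens T (fun=> h)) w =
    scaled_hermite (sqnorm (hdot G) h) (W h w) n}.
Proof.
move=> hS; have [t ->] := lin_span_range hS.
have Dsub := subspace_closed_span (T := T) (range (symm T)).
have Wsum := ae_linear_sum (subspaceT G) W_lin t (G := eta) (fun=> Logic.I).
have symF v : sym_power T (symm T (ord_fun (map eta v))).
  by apply: sub_closed_span; eexists.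
have := ae_linear_wsum t Dsub (wiener_linear Int_wiener) symF wiener_word.
rewrite -symm_diag_wsum; move: Wsum; apply: filterS2 => w Wsum ->.
rewrite wsum_prod_hermite Wsum; congr scaled_hermite.
rewrite /sqnorm linear_sumlz; apply: eq_bigr => a _.
rewrite linearZl_LR linear_sumr /GRing.scale /= mulr_sumr; apply: eq_bigr => b _.
by rewrite linearZr_LR /= eta_on mulrA.
Qed.
End WienerDiagonal.

(** * Complex integrals of block tensors *)

Section ComplexIntegral.
Context {R : realType} {d : measure_display} {Omega : measurableType d}.
Variable P : probability Omega R.
Variables (H : real_hilbert R) (X Y : H -> {RV P >-> R}).
Hypotheses (X_iso : isonormal X) (Y_iso : isonormal Y).
Local Notation C := R[i].
Local Notation W := (Wproc X Y).
Local Notation Z := (Zproc X Y).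
Local Notation G := (dsum H H).

Lemma Wproc_linear : ae_linear P [set: G] W.
Proof.
move=> a g h _ _; have XE := isonormal_linear X_iso a (g := g.1) (g' := h.1) Logic.I Logic.I.
have YE := isonormal_linear Y_iso a (g := g.2) (g' := h.2) Logic.I Logic.I.
by apply: filterS2 XE YE => w XE YE; rewrite /Wproc /= XE YE; ring.
Qed.

Lemma Wproc_continuous : ae_continuous P [set: G] W.
Proof.
move=> u v c _ _ uv.
have uv1 m : sqnorm (hdot H) ((u m).1 - v.1) <= c / 2 ^+ m.
  by rewrite (le_trans _ (uv m)) // lerDl sqnorm_ge0.
have uv2 m : sqnorm (hdot H) ((u m).2 - v.2) <= c / 2 ^+ m.
  by rewrite (le_trans _ (uv m)) // lerDr sqnorm_ge0.
have Xu := isonormal_continuous X_iso (u := fun m => (u m).1) (fun=> Logic.I) Logic.I uv1.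
have Yu := isonormal_continuous Y_iso (u := fun m => (u m).2) (fun=> Logic.I) Logic.I uv2.
by apply: filterS2 Xu Yu => w Xu Yu; exact: cvgD.
Qed.

Lemma Zproc_linear : ae_linear P [set: cplx H] Z.
Proof.
have iso_lin3 (X' : H -> {RV P >-> R}) : isonormal X' -> forall (a b : R) (f g h : H),
    {ae P, forall w, X' (a *: f + b *: g + h) w = a * X' f w + b * X' g w + X' h w}.
  move=> X'_iso a b f g h.
  have E1 := isonormal_linear X'_iso a (g := f) (g' := b *: g + h) Logic.I Logic.I.
  have E2 := isonormal_linear X'_iso b (g := g) (g' := h) Logic.I Logic.I.
  by apply: filterS2 E1 E2 => w; rewrite -addrA => -> ->; rewrite addrA.
case=> a b [f g] [f' g'] _ _.
have X1 := iso_lin3 X X_iso a (- b) f g f'.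
have X2 := iso_lin3 X X_iso a b g f g'.
have Y1 := iso_lin3 Y Y_iso a (- b) f g f'.
have Y2 := iso_lin3 Y Y_iso a b g f g'.
apply: filterS2 (filterI X1 X2) (filterI Y1 Y2) => w [X1w X2w] [Y1w Y2w].
rewrite /Zproc /complexify mulrA -mulrDl; congr (_ / _).
rewrite [cre _]/(a *: f - b *: g + f') [cim _]/(a *: g + b *: f + g').
rewrite -[- (b *: g)]scaleNr X1w X2w Y1w Y2w /cre /cim /=.
by apply/eqP; rewrite eq_complex /=; apply/andP; split; apply/eqP; ring.
Qed.

(** For h = (f, g), Z(f - i g) = (X(f) + Y(g) + i (Y(f) - X(g))) / sqrt 2; minus signs leave X and Y
    only almost surely. *)
Lemma Zproc_twist (h : G) :
  {ae P, forall w, Z (twist h) w + conjc (Z (twist h) w) = (Num.sqrt 2 * W h w)%:C%C}.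
Proof.
have XN := ae_linearZ (subspaceT H) (isonormal_linear X_iso) (-1) (g := h.2) Logic.I.
have YN := ae_linearZ (subspaceT H) (isonormal_linear Y_iso) (-1) (g := h.2) Logic.I.
apply: filterS2 XN YN => w; rewrite scaleN1r => XN YN.
have s2 : Num.sqrt 2 != 0 :> R by rewrite gt_eqF // sqrtr_gt0.
have s22 : Num.sqrt 2 * Num.sqrt 2 = 2 :> R by rewrite -expr2 sqr_sqrtr.
have -> : Z (twist h) w = (Num.sqrt 2)^-1%:C%C *
    ((X h.1 w + Y h.2 w) +i* (Y h.1 w - X h.2 w))%C.
  rewrite /Zproc /complexify /twist /cre /cim /= XN YN fmorphV mulrC; congr (_ * _).
  by apply/eqP; rewrite eq_complex /=; apply/andP; split; apply/eqP; ring.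
rewrite /Wproc; apply/eqP; rewrite eq_complex /=; apply/andP; split; apply/eqP; last by ring.
rewrite !mul0r subr0 -mulrDl.
transitivity ((Num.sqrt 2 * Num.sqrt 2) / Num.sqrt 2 * (X h.1 w + Y h.2 w)).
  by rewrite s22; ring.
by rewrite mulfK.
Qed.

Variable J : nat -> nat -> C -> C.
Hypothesis J_cherm : forall p q z, J p q z = cherm 2 z (conjc z) p q.
Variables (I : countType) (xi : I -> cplx H).
Hypothesis xi_on : forall i j, '<xi i, xi j> = (i == j)%:R.

Section Words.
Variables (n k : nat) (T : tensor_power (cplx H) n) (Int : T -> Omega -> C).
Hypotheses (kn : (k <= n)%N) (Int_complex : is_complex_integral P J Z xi k Int).

Lemma complex_word (v u : seq I) : size v = k -> size u = (n - k)%N ->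
  {ae P, forall w,
    Int (split_symm T k (ord_fun (map xi v ++ map (fun i => cconj (xi i)) u))) w =
    \prod_(i <- undup (v ++ u)) cherm 1 (Z (xi i) w) (conjc (Z (xi i) w))
      (count_mem i v) (count_mem i u)}.
Proof.
move=> vk uk; have [m [mE msz mw mfin]] := multi_index_of v.
have [m' [m'E m'sz m'w m'fin]] := multi_index_of u.
have := complex_basis Int_complex (etrans msz vk) (etrans m'sz uk); apply: filterS => w.
pose f (x : I * bool) : cplx H := if x.2 then xi x.1 else cconj (xi x.1).
pose word (a b : seq I) := [seq (i, true) | i <- a] ++ [seq (i, false) | i <- b].
have fword a b : map f (word a b) = map xi a ++ map (fun i => cconj (xi i)) b.
  by rewrite map_cat -!map_comp.
have tag_word a b : size a = k -> size b = (n - k)%N ->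
    forall x0 (l : 'I_n), (nth x0 (word a b) l).2 = (l < k)%N.
  move=> ak bk [i0 b0] l; rewrite nth_cat size_map ak; case: ltnP => lk.
    by rewrite (nth_map i0) ?ak.
  by rewrite (nth_map i0) // bk ltn_sub2r // (leq_ltn_trans lk).
rewrite -!fword (@split_symm_perm_eq _ _ _ _ _ _ f k snd _ (word v u)).
- move=> ->; rewrite (perm_big (undup (v ++ u))).
    apply: eq_bigr => i _; rewrite mE m'E J_cherm conjc_realM.
    have s2 : (Num.sqrt 2)%:C%C != 0 :> C by rewrite fmorph_eq0 gt_eqF // sqrtr_gt0.
    (* Homogeneity of [cherm] absorbs both the powers of sqrt 2 in front and the sqrt 2 in the
       argument, leaving variance 1. *)
    have -> : 2 = (Num.sqrt 2)%:C%C ^+ 2 * 1 :> C.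
      by rewrite mulr1 -rmorphXn sqr_sqrtr // rmorph_nat.
    by rewrite chermM mulKf // expf_neq0.
  apply: uniq_perm; rewrite ?fset_uniq ?undup_uniq // => i.
  by rewrite in_fsetU !(perm_mem mfin, perm_mem m'fin) !mem_undup mem_cat.
- by rewrite size_cat !size_map (perm_size mw) (perm_size m'w) vk uk subnKC.
- by rewrite perm_cat ?perm_map.
- by apply: tag_word; rewrite ?(perm_size mw) ?(perm_size m'w).
- exact: tag_word.
Qed.

Lemma complex_block (s : seq (C * I)) :
  {ae P, forall w,
    Int (block_tensor T k (\sum_(x <- s) x.1 *: xi x.2)
           (cconj (\sum_(x <- s) x.1 *: xi x.2))) w =
    wsum s k (fun v => wsum [seq (conjc x.1, x.2) | x <- s] (n - k) (fun u =>
      \prod_(i <- undup (v ++ u)) cherm 1 (Z (xi i) w) (conjc (Z (xi i) w))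
      (count_mem i v) (count_mem i u) : C^o))}.
Proof.
set t := [seq _ | _ <- s].
have -> : cconj (\sum_(x <- s) x.1 *: xi x.2) = \sum_(x <- t) x.1 *: cconj (xi x.2).
  by rewrite cconj_sum big_map.
rewrite (block_tensor_wsum T kn s t xi (fun i => cconj (xi i))).
have Dsub := subspace_closed_span (T := T) (range (split_symm T k)).
have lin := complex_linear Int_complex.
have splitF v u : split_sym_power T k
    (split_symm T k (ord_fun (map xi v ++ map (fun i => cconj (xi i)) u))).
  by apply: sub_closed_span; eexists.
apply: (ae_linear_wsum (b := fun v w => wsum t (n - k) (fun u =>
      \prod_(i <- undup (v ++ u)) cherm 1 (Z (xi i) w) (conjc (Z (xi i) w))
      (count_mem i v) (count_mem i u) : C^o)) s Dsub lin) => [v|v vk].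
  exact: (subspace_wsum t (n - k) Dsub (splitF v)).
by apply: (ae_linear_wsum t Dsub lin (splitF v)) => u uk; exact: complex_word.
Qed.
End Words.

Section ChaosSum.
Variables (n : nat) (T : tensor_power H n).
Variable Ic : nat -> cplx_power T -> Omega -> C.
Hypothesis Ic_complex : forall k, (k <= n)%N -> is_complex_integral P J Z xi k (Ic k).

Definition chaos_coef k : R := Num.sqrt 2 ^- n * n`!%:R / (k`! * (n - k)`!)%:R.

Definition chaos_sum (g : dsum_power T) (w : Omega) : C :=
  \sum_(k < n.+1) Ic k ((chaos_coef k)%:C%C *: Vsum g 0 k) w.

Lemma chaos_sum_diag_span (h : G) : lin_span (range xi) (twist h) ->
  {ae P, forall w, chaos_sum (tens (dsum_power T) (fun=> h)) w =
    (scaled_hermite (sqnorm (hdot G) h) (W h w) n)%:C%C}.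
Proof.
move=> hS; have [t tE] := lin_span_range hS.
have Zsum := ae_linear_sum (subspaceT (cplx H)) Zproc_linear t (G := xi) (fun=> Logic.I).
have IcE : {ae P, forall w, forall k, (k <= n)%N ->
    Ic k ((chaos_coef k)%:C%C *: Vsum (tens (dsum_power T) (fun=> h)) 0 k) w =
    (chaos_coef k)%:C%C * wsum t k (fun v =>
      wsum [seq (conjc x.1, x.2) | x <- t] (n - k) (fun u =>
      \prod_(i <- undup (v ++ u)) cherm 1 (Z (xi i) w) (conjc (Z (xi i) w))
      (count_mem i v) (count_mem i u) : C^o))}.
  apply: ae_foralln => k; have [kn|_] := boolP (k <= n)%N; last exact: aeW.
  have Dsub := subspace_closed_span (T := cplx_power T) (range (split_symm (cplx_power T) k)).
  have split_block := split_sym_power_block (cplx_power T) kn (twist h) (cconj (twist h)).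
  have := ae_linearZ Dsub (complex_linear (Ic_complex kn)) (chaos_coef k)%:C%C split_block.
  have := complex_block kn (Ic_complex kn) t; rewrite -tE.
  by apply: filterS2 => w blockE ZE _; rewrite Vsum_diag ZE blockE.
apply: filterS3 (Zproc_twist h) Zsum IcE => w; rewrite tE => twistE ZE IE.
rewrite /chaos_sum (eq_bigr (fun k : 'I_n.+1 => (Num.sqrt 2 ^- n)%:C%C * ('C(n, k)%:R *
  wsum t k (fun v => wsum [seq (conjc x.1, x.2) | x <- t] (n - k) (fun u =>
      \prod_(i <- undup (v ++ u)) cherm 1 (Z (xi i) w) (conjc (Z (xi i) w))
      (count_mem i v) (count_mem i u) : C^o))))); last first.
  move=> k _; have kn : (k <= n)%N by rewrite -ltnS.
  rewrite IE // mulrA; congr (_ * _); rewrite /chaos_coef -mulrA rmorphM; congr (_ * _).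
  have f0 : (k`! * (n - k)`!)%:R != 0 :> R by rewrite pnatr_eq0 -lt0n muln_gt0 !fact_gt0.
  by rewrite -(bin_fact kn) natrM mulfK // rmorph_nat.
rewrite -mulr_sumr sum_wsum_prod_cherm.
have -> : \sum_(a <- t) a.1 * Z (xi a.2) w +
    \sum_(b <- [seq (conjc x.1, x.2) | x <- t]) b.1 * conjc (Z (xi b.2) w) =
    (Num.sqrt 2)%:C%C * (W h w)%:C%C.
  transitivity ((Num.sqrt 2 * W h w)%:C%C); last by rewrite rmorphM.
  rewrite -twistE ZE rmorph_sum big_map; congr (_ + _).
  by apply: eq_bigr => b _; exact/esym/rmorphM.
(* The coefficients of the second alphabet are the conjugates, so orthonormality turns the double
   sum into the squared norm of [twist h]. *)
have -> : 2 * 1 * (\sum_(a <- t) \sum_(b <- [seq (conjc x.1, x.2) | x <- t])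
    a.1 * b.1 * (a.2 == b.2)%:R) = (Num.sqrt 2)%:C%C ^+ 2 * (sqnorm (hdot G) h)%:C%C.
  rewrite -sqnorm_twist mulr1 -rmorphXn sqr_sqrtr // rmorph_nat; congr (_ * _).
  rewrite tE /sqnorm linear_sumlz; apply: eq_bigr => a _.
  rewrite linearZl_LR linear_sumr /= big_map mulr_sumr; apply: eq_bigr => b _.
  by rewrite linearZr_LR /= xi_on mulrA.
rewrite scaled_hermiteM rmorph_scaled_hermite mulrA -rmorphXn -rmorphM.
by rewrite mulVf ?rmorph1 ?mul1r // expf_neq0 // gt_eqF // sqrtr_gt0.
Qed.
End ChaosSum.
End ComplexIntegral.

(** * The real integral as a sum of complex integrals *)

Section ChaosDecomposition.
Context {R : realType} {d : measure_display} {Omega : measurableType d}.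
Variable P : probability Omega R.
Variables (H : real_hilbert R) (n : nat) (T : tensor_power H n).
Local Notation C := R[i].

(** [Vsum] is bounded and maps diagonal tensors to block tensors, so it maps the closed span of the
    former into that of the latter. *)
Lemma Vsum_split_sym_power k (g : dsum_power T) : (k <= n)%N ->
  sym_power (dsum_power T) g -> split_sym_power (cplx_power T) k (Vsum g 0 k).
Proof.
move=> kn Sg; have Dsub := subspace_closed_span (T := cplx_power T)
  (range (split_symm (cplx_power T) k)).
(* A closed span contains its own closure, so approximation by its elements suffices. A positive
   bound in [R[i]] has imaginary part 0, which reduces the estimate to real numbers. *)
apply: (closed_span_le (S := split_sym_power (cplx_power T) k)) => // -[e e'] e0.
have /= [/eqP e'0 {}e0] := (andP (etrans (esym (ltcE _ _)) e0)).
rewrite /= in e'0 e0; rewrite e'0.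
pose c : R := 2 ^+ (2 ^ n).
have c0 : 0 < c by rewrite exprn_gt0.
have [v Sv gv] := sym_power_span Sg (divr_gt0 e0 c0).
exists (Vsum v 0 k).
  exists [:: (1, Vsum v 0 k)]; last by rewrite big_seq1 scale1r.
  move=> x; rewrite inE => /eqP -> /=.
  have [s sS ->] := Sv; elim: s sS => [|x' s IHs] sS.
    have := Vsum0Z (T := T) k 0 0; rewrite big_nil scale0r => ->.
    by rewrite rmorph0 scale0r; exact: Dsub.1.
  rewrite big_cons Vsum0D Vsum0Z; apply: Dsub.2.
    have [h _ <-] := sS x' (mem_head _ _); rewrite Vsum_diag.
    exact: split_sym_power_block.
  by apply: IHs => y ys; apply: sS; rewrite inE ys orbT.
rewrite (_ : Vsum g 0 k - Vsum v 0 k = Vsum (g - v) 0 k); last first.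
  by rewrite -[- v]scaleN1r Vsum0D Vsum0Z rmorphN rmorph1 scaleN1r.
rewrite (le_lt_trans (sqnorm_Vsum_le _ _)) // ltcR -/c mulrC -ltr_pdivlMr //.
Qed.

Variables (X Y : H -> {RV P >-> R}) (J : nat -> nat -> C -> C).
Variables (I : countType) (xi : I -> cplx H).
Variable Ic : nat -> cplx_power T -> Omega -> C.
Hypothesis Ic_complex : forall k, (k <= n)%N ->
  is_complex_integral P J (Zproc X Y) xi k (Ic k).

Local Notation Sym := (sym_power (dsum_power T)).
Let A k g := (@chaos_coef R n k)%:C%C *: Vsum (T := T) g 0 k : cplx_power T.

Let A_linear k (a : R) g g' : A k (a *: g + g') = a%:C%C *: A k g + A k g'.
Proof. by rewrite /A Vsum0D Vsum0Z scalerDr !scalerA mulrC. Qed.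

Let A_split k g : (k <= n)%N -> Sym g -> split_sym_power (cplx_power T) k (A k g).
Proof. by move=> kn Sg; apply/closed_spanZ/Vsum_split_sym_power. Qed.

Let Sym_sub : subspace Sym := subspace_closed_span (range (symm (dsum_power T))).

Let Ic_linear k (a : R) g g' : (k <= n)%N -> Sym g -> Sym g' ->
  {ae P, forall w, Ic k (A k (a *: g + g')) w = a%:C%C * Ic k (A k g) w + Ic k (A k g') w}.
Proof.
move=> kn Sg Sg'; rewrite A_linear.
by apply: (complex_linear (Ic_complex kn)); exact: A_split.
Qed.

Let ReIc_linear k : (k <= n)%N -> ae_linear P Sym (fun g w => Re (Ic k (A k g) w)).
Proof.
move=> kn a g g' Sg Sg'; have := Ic_linear a kn Sg Sg'; apply: filterS => w ->.
by case: (Ic k (A k g) w) => x y; case: (Ic k (A k g') w) => x' y' /=; ring.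
Qed.

Let ImIc_linear k : (k <= n)%N -> ae_linear P Sym (fun g w => Im (Ic k (A k g) w)).
Proof.
move=> kn a g g' Sg Sg'; have := Ic_linear a kn Sg Sg'; apply: filterS => w ->.
by case: (Ic k (A k g) w) => x y; case: (Ic k (A k g') w) => x' y' /=; ring.
Qed.

(** The factorials come from the isometry, the square from [chaos_coef], and the power of 2 from
    [sqnorm_Vsum_le]. *)
Let c0 k : R := (k`! * (n - k)`!)%:R * (@chaos_coef R n k ^+ 2 * 2 ^+ (2 ^ n)).

Let c0_ge0 k : 0 <= c0 k.
Proof. by rewrite mulr_ge0 ?mulr_ge0 ?sqr_ge0 ?exprn_ge0. Qed.

Let Ic_bound k g : (k <= n)%N -> Sym g ->
  ('E_P[fun w => (Re (Ic k (A k g) w) ^+ 2 + Im (Ic k (A k g) w) ^+ 2)%R] <=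
    (c0 k * sqnorm (hdot (dsum_power T)) g)%:E)%E.
Proof.
move=> kn Sg; rewrite (complex_isometry (Ic_complex kn) (A_split kn Sg)) lee_fin.
rewrite /c0 -mulrA ler_wpM2l //.
have := sqnorm_Vsum_le k g.
rewrite [X in X <= _](_ : _ =
  (Re (sqnorm (hdot (cplx_power T)) (Vsum g 0 k)))%:C%C); last first.
  by rewrite [sqnorm _ _]sqnorm_cplx.
rewrite lecR => le_g.
have -> : '<A k g, A k g> =
    (@chaos_coef R n k ^+ 2)%:C%C * sqnorm (hdot (cplx_power T)) (Vsum g 0 k).
  rewrite -[LHS]/(sqnorm (hdot (cplx_power T)) (A k g)) sqnormZ conjc_real.
  by rewrite -rmorphM expr2.
rewrite [sqnorm _ _]sqnorm_cplx -rmorphM /= -mulrA ler_wpM2l ?sqr_ge0 //.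
Qed.

Let mRe k g : (k <= n)%N -> Sym g ->
  measurable_fun [set: Omega] (fun w => Re (Ic k (A k g) w)).
Proof.
move=> kn Sg; have [+ _] := complex_L2 (Ic_complex kn) (A_split kn Sg).
by rewrite inE => /andP[]; rewrite inE.
Qed.

Let mIm k g : (k <= n)%N -> Sym g ->
  measurable_fun [set: Omega] (fun w => Im (Ic k (A k g) w)).
Proof.
move=> kn Sg; have [_ +] := complex_L2 (Ic_complex kn) (A_split kn Sg).
by rewrite inE => /andP[]; rewrite inE.
Qed.

Lemma ReIc_continuous k : (k <= n)%N ->
  ae_continuous P Sym (fun g w => Re (Ic k (A k g) w)).
Proof.
move=> kn; apply: (ae_continuous_L2 Sym_sub (ReIc_linear kn)
  (M := fun g w => Im (Ic k (A k g) w)) (c0 := c0 k)) => // g Sg.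
- exact: mRe.
- exact: mIm.
- exact: Ic_bound.
Qed.

Lemma ImIc_continuous k : (k <= n)%N ->
  ae_continuous P Sym (fun g w => Im (Ic k (A k g) w)).
Proof.
move=> kn; apply: (ae_continuous_L2 Sym_sub (ImIc_linear kn)
  (M := fun g w => Re (Ic k (A k g) w)) (c0 := c0 k)) => // g Sg.
- exact: mIm.
- exact: mRe.
- by under [X in 'E_P[X]%E]eq_fun do rewrite addrC; exact: Ic_bound.
Qed.

Hypotheses (X_iso : isonormal X) (Y_iso : isonormal Y).
Variables (herm : nat -> R -> R) (I1 : countType) (eta : I1 -> dsum H H).
Variable Ip : dsum_power T -> Omega -> R.
Hypotheses (herm_hermite : is_hermite herm) (J_hermite : is_complex_hermite J).
Hypotheses (eta_cons : is_cons eta) (xi_cons : is_cons xi).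
Hypothesis Ip_wiener : is_wiener_integral P herm (Wproc X Y) eta Ip.

Let Ip_linear : ae_linear P Sym Ip := wiener_linear Ip_wiener.

Let Ip_continuous : ae_continuous P Sym Ip.
Proof.
apply: (ae_continuous_L2 Sym_sub Ip_linear (M := fun=> cst 0) (c0 := n`!%:R)) => // g Sg.
  by have := wiener_L2 Ip_wiener Sg; rewrite inE => /andP[]; rewrite inE.
rewrite (_ : (fun w => _) = (fun w => (Ip g w ^+ 2)%R)).
  by rewrite (wiener_isometry Ip_wiener).
by apply/funext => w; rewrite /= expr0n addr0.
Qed.

Let W_cont := Wproc_continuous X_iso Y_iso.

Lemma Ip_diag (h : dsum H H) : {ae P, forall w, Ip (tens (dsum_power T) (fun=> h)) w =
  1 * scaled_hermite (sqnorm (hdot (dsum H H)) h) (Wproc X Y h w) n}.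
Proof.
apply: (diag_extension Ip_continuous W_cont (S := lin_span (range eta))) => {}h; last first.
  move=> Sh; have := wiener_diag_span herm_hermite Ip_wiener eta_cons.1
    (Wproc_linear X_iso Y_iso) Sh.
  by apply: filterS => w; rewrite mul1r.
by move=> e e0; exact: (eta_cons.2 h e e0).
Qed.

Let twist_dense (h : dsum H H) (e : R) : 0 < e ->
  exists2 x, lin_span (range xi) (twist x) & sqnorm (hdot (dsum H H)) (h - x) < e.
Proof.
move=> e0; have eC : 0 < e%:C%C by rewrite ltcR.
have [v Sv hv] := xi_cons.2 (twist h) _ eC.
have vE : twist (v.1, - v.2) = v by case: (v) => a b; rewrite /twist /cpair /= opprK.
(* [twist] is an isometry and this is the preimage of [v], so density in H_C pulls back. *)
exists (v.1, - v.2); first by rewrite vE.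
by move: hv; rewrite -{1}vE -twistB sqnorm_twist ltcR.
Qed.

Let J_cherm := complex_hermiteE herm_hermite J_hermite.

Let chaos_sum_span (h : dsum H H) : lin_span (range xi) (twist h) ->
  {ae P, forall w, chaos_sum Ic (tens (dsum_power T) (fun=> h)) w =
    (scaled_hermite (sqnorm (hdot (dsum H H)) h) (Wproc X Y h w) n)%:C%C} :=
  @chaos_sum_diag_span _ _ _ P H X Y X_iso Y_iso J J_cherm I xi xi_cons.1 n T Ic Ic_complex h.

Let Re_sum g w := \sum_(k < n.+1) Re (Ic k (A k g) w).
Let Im_sum g w := \sum_(k < n.+1) Im (Ic k (A k g) w).

Let chaos_sumE g w : chaos_sum Ic g w = (Re_sum g w +i* Im_sum g w)%C.
Proof.
apply/eqP; rewrite eq_complex /Re_sum /Im_sum /chaos_sum /=.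
by rewrite !raddf_sum !eqxx.
Qed.

Let ord_le (k : 'I_n.+1) : (k <= n)%N. Proof. by rewrite -ltnS. Qed.

Let Re_sum_continuous : ae_continuous P Sym Re_sum.
Proof. by apply: ae_continuous_bigsum => k; exact: ReIc_continuous. Qed.

Let Im_sum_continuous : ae_continuous P Sym Im_sum.
Proof. by apply: ae_continuous_bigsum => k; exact: ImIc_continuous. Qed.

Let Re_sum_linear : ae_linear P Sym Re_sum.
Proof. by apply: ae_linear_bigsum => k; exact: ReIc_linear. Qed.

Let Im_sum_linear : ae_linear P Sym Im_sum.
Proof. by apply: ae_linear_bigsum => k; exact: ImIc_linear. Qed.

(** Each side is first known on its own dense set of h; both are extended to all h before being
    subtracted, and the difference then vanishes on diagonal tensors. The imaginary part is shown to
    vanish separately. *)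
Lemma wiener_chaos_sum g : Sym g ->
  {ae P, forall w, (Ip g w)%:C%C = chaos_sum Ic g w}.
Proof.
move=> Sg.
have Re_diag h := @diag_extension _ _ _ P _ _ _ _ Re_sum_continuous (Wproc X Y)
  [set x | lin_span (range xi) (twist x)] 1 W_cont twist_dense.
have Im_diag h := @diag_extension _ _ _ P _ _ _ _ Im_sum_continuous (Wproc X Y)
  [set x | lin_span (range xi) (twist x)] 0 W_cont twist_dense.
have ReE : {ae P, forall w, Ip g w + -1 * Re_sum g w = 0}.
  apply: (sym_power_vanish (L := fun g w => Ip g w + -1 * Re_sum g w)) => // [||h].
  - exact: ae_continuousD.
  - exact: ae_linearD.
  have Re_h : {ae P, forall w, Re_sum (tens (dsum_power T) (fun=> h)) w =
      1 * scaled_hermite (sqnorm (hdot (dsum H H)) h) (Wproc X Y h w) n}.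
    apply: Re_diag => // x /chaos_sum_span; apply: filterS => w.
    by rewrite chaos_sumE mul1r => -[].
  by apply: filterS2 (Ip_diag h) Re_h => w -> ->; ring.
have ImE : {ae P, forall w, Im_sum g w = 0}.
  apply: (sym_power_vanish Im_sum_continuous Im_sum_linear) => // h.
  have Im_h : {ae P, forall w, Im_sum (tens (dsum_power T) (fun=> h)) w =
      0 * scaled_hermite (sqnorm (hdot (dsum H H)) h) (Wproc X Y h w) n}.
    apply: Im_diag => // x /chaos_sum_span; apply: filterS => w.
    by rewrite chaos_sumE mul0r => -[].
  by apply: filterS Im_h => w ->; rewrite mul0r.
apply: filterS2 ReE ImE => w /eqP; rewrite mulN1r subr_eq0 => /eqP -> Im0.
by rewrite chaos_sumE Im0.
Qed.

Lemma chaos_sum_pair g1 g2 : Sym g1 -> Sym g2 ->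
  {ae P, forall w, (Ip g1 w +i* Ip g2 w)%C =
    \sum_(k < n.+1) Ic k ((@chaos_coef R n k)%:C%C *: Vsum g1 g2 k) w}.
Proof.
move=> S1 S2.
have AE : {ae P, forall w, forall k, (k <= n)%N ->
    Ic k ((@chaos_coef R n k)%:C%C *: Vsum g1 g2 k) w =
      'i%C * Ic k (A k g2) w + Ic k (A k g1) w}.
  apply: ae_foralln => k; have [kn|_] := boolP (k <= n)%N; last exact: aeW.
  have := complex_linear (Ic_complex kn) 'i%C (A_split kn S2) (A_split kn S1).
  apply: filterS => w <- _; congr (Ic k _ w).
  by rewrite Vsum_split /A scalerDr !scalerA mulrC.
apply: filterS3 (wiener_chaos_sum S1) (wiener_chaos_sum S2) AE => w E1 E2 AE.
rewrite (eq_bigr (fun k : 'I_n.+1 => 'i%C * Ic k (A k g2) w + Ic k (A k g1) w)); last first.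
  by move=> k _; rewrite AE.
rewrite big_split -mulr_sumr /= -[X in _ = _ * X + _]E2 -[X in _ = _ + X]E1.
by apply/eqP; rewrite eq_complex /=; apply/andP; split; apply/eqP; ring.
Qed.
End ChaosDecomposition.

Theorem theorem4p4 (R : realType) (d : measure_display)
    (Omega : measurableType d) (P : probability Omega R)
    (H : real_hilbert R) (H_separable : separable H)
    (X Y : H -> {RV P >-> R}) (X_isonormal : isonormal X)
    (Y_isonormal : isonormal Y) (XY_indep : independent_families X Y)
    (herm : nat -> R -> R) (herm_hermite : is_hermite herm)
    (J : nat -> nat -> R[i] -> R[i]) (J_hermite : is_complex_hermite J)
    (I1 : countType) (eta : I1 -> dsum H H) (eta_cons : is_cons eta)
    (I2 : countType) (xi : I2 -> cplx H) (xi_cons : is_cons xi)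
    (p : nat) (p_ge1 : (1 <= p)%N) (T : tensor_power H p)
    (Ip : dsum_power T -> Omega -> R)
    (Ip_integral : is_wiener_integral P herm (Wproc X Y) eta Ip)
    (Ic : nat -> cplx_power T -> Omega -> R[i])
    (Ic_integral : forall k, (k <= p)%N ->
       is_complex_integral P J (Zproc X Y) xi k (Ic k))
    (g1 g2 : dsum_power T)
    (g1_sym : sym_power (dsum_power T) g1) (g2_sym : sym_power (dsum_power T) g2)
    (k : nat) :
  unique (fun k => [/\ (k <= p)%N, Vsum g1 g2 k <> 0 &
            forall l, (l <= p)%N -> l <> k -> Vsum g1 g2 l = 0]) k ->
  {ae P, forall w,
    (Ip g1 w +i* Ip g2 w)%C =
    Ic k ((Num.sqrt 2 ^- p * p`!%:R / (k`! * (p - k)`!)%:R)%:C%C *: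
            Vsum g1 g2 k) w}.
Proof.
move=> [[kp _ V0] _].
(* Linearity holds only almost surely, so even the integral of 0 vanishes off a null set, one for
   each [l <= p]. *)
have Ic0 : {ae P, forall w, forall l, (l <= p)%N -> Ic l 0 w = 0}.
  apply: ae_foralln => l; have [lp|_] := boolP (l <= p)%N; last exact: aeW.
  have Dsub := subspace_closed_span (T := cplx_power T) (range (split_symm (cplx_power T) l)).
  by apply: filterS (ae_linear0 Dsub (complex_linear (Ic_integral l lp))) => w ->.
have := chaos_sum_pair Ic_integral X_isonormal Y_isonormal herm_hermite J_hermite
  eta_cons xi_cons Ip_integral g1_sym g2_sym.
apply: filterS2 Ic0 => w Ic0 ->.
have kp1 : (k < p.+1)%N by [].
rewrite (bigD1 (Ordinal kp1)) //= big1 ?addr0 // => l lk.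
have lp : (l <= p)%N by rewrite -ltnS.
by rewrite V0 // ?scaler0 ?Ic0 // => lkE; move/eqP: lk; apply; exact: val_inj.
Qed.
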